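(* For $\theta\in\left(\frac\pi4,\frac\pi3\right]\cup\left[\frac{2\pi}3,\frac{3\pi}4\right)$ put $F_0(\theta)=\sqrt{1-8\cos(2\theta)-8\cos(4\theta)}$ and define $r_1(\theta),r_2(\theta)>0$ by $$R(r_1(\theta))=\frac{1}{8\sqrt2}\,\frac{\sqrt{F_0(\theta)-3}}{\cos\theta\,\cos(2\theta)}\left[F_0(\theta)+3+4\cos(2\theta)\right],\qquad R(r_2(\theta))=-\frac{\sqrt{F_0(\theta)-3}}{\sqrt2},$$ where $R(r)=r-\frac1r$. Then: 1. For each such $\theta$, the list $(c,a_1,a_2,a_3)=\left(i,\ r_1(\theta),\ r_2(\theta)e^{i\theta},\ r_2(\theta)e^{-i\theta}\right)$ is a solution of the period problem with complexity $m=2$, hence it defines a non-orientable (1-sided) branched minimal surface $H(\theta)$. The surfaces $H(\theta)$ and $H(\pi-\theta)$ are congruent. 2. $\lim_{\theta\to(\pi/3)^-}R(r_1(\theta))=\lim_{\theta\to(\pi/3)^-}R(r_2(\theta))=0$, which implies $\lim_{\theta\to(\pi/3)^-}H(\theta)=H_2$. 3. $\lim_{\theta\to(\pi/4)^+}R(r_1(\theta))=-\infty$ and $\lim_{\theta\to(\pi/4)^+}R(r_2(\theta))=0$, so that the list $(c,a_1,a_2,a_3)$ converges to $(i,0,e^{i\pi/4},e^{-i\pi/4})$ as $\theta\to(\pi/4)^+$. Writing $f_\theta\,dz$ for the form $\omega$ of $H(\theta)$, the rescaled surface $r_1(\theta)H(\theta)$ has Weierstrass data $g(z)=z$, $r_1(\theta)f_\theta(z)\,dz$,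 and for each fixed $z\in\mathbb{C}\setminus\{0\}$ $$\lim_{\theta\to(\pi/4)^+}r_1(\theta)f_\theta(z)=\widehat f(z):=\frac{i}{z^4}\left(z-e^{i\pi/4}\right)\left(z+e^{i\pi/4}\right)\left(z-e^{-i\pi/4}\right)\left(z+e^{-i\pi/4}\right).$$ The limit surface of $r_1(\theta)H(\theta)$ as $\theta\to(\pi/4)^+$, i.e. the surface with Weierstrass data $g(z)=z$, $\omega=\widehat f\,dz$, is (up to congruence) the Henneberg surface $H_1$.
   Context: For $m\in\mathbb{N}$ and $(c,a_1,\dots,a_{m+1})\in\mathbb{S}^1\times(\mathbb{C}\setminus\{0\})^{m+1}$, put $$P(z)=\prod_{j=1}^{m+1}(z-a_j)\Big(z+\frac1{\overline{a_j}}\Big)=\sum_{h=0}^{2m+2}A_hz^h,\qquad f(z)=\frac{c}{z^{m+3}}P(z).$$ The list is a solution of the period problem with complexity $m$ if $$-\frac{\overline c}{c}=\prod_{j=1}^{m+1}\frac{a_j}{\overline{a_j}},\qquad \overline{cA_m}=-cA_{m+2},\qquad \mathrm{Im}(cA_{m+1})=0 .$$ In that case, with Weierstrass data $g(z)=z$ and $\omega=f\,dz$, the formula $X=\mathrm{Re}\int\left(\frac12(1-g^2)\omega,\frac i2(1+g^2)\omega,g\omega\right)$ gives a well-defined branched minimal immersion $\mathbb{C}\setminus\{0\}\to\mathbb{R}^3$ (up to translation) that descends to the quotient by $z\mapsto-1/\overline z$; this is the 1-sided branched minimal surface defined by the list. $H_2$ is the surface given by $g(z)=z$, $\omega=i\,z^{-5}(z^6-1)\,dz$,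 and $H_1$ (Henneberg's surface) the one given by $g(z)=z$, $\omega=z^{-4}(z^4-1)\,dz$. For $\lambda>0$, $\lambda H(\theta)$ denotes the image of $H(\theta)$ under the homothety of ratio $\lambda$. Congruent means equal up to an isometry of $\mathbb{R}^3$. The function $R\colon(0,\infty)\to\mathbb{R}$ is a bijection, and $F_0(\theta)\ge 3$ for the given $\theta$, so $r_1(\theta),r_2(\theta)$ are well defined. *)

(* Defs.v *)
From HB Require Import structures.
From mathcomp Require Import all_boot all_order all_algebra.
From mathcomp Require Import complex ring lra.
From mathcomp Require Import all_classical all_reals all_analysis.

Set Implicit Arguments.
Unset Strict Implicit.
Unset Printing Implicit Defensive.

Import Order.TTheory GRing.Theory Num.Theory.
Import numFieldNormedType.Exports.

Local Open Scope classical_set_scope.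
Local Open Scope ring_scope.

(* The complex plane is [R[i]]; its topology is carried by the alias
   [R[i]^o].  Maps on the punctured plane are total functions on [R[i]] whose
   value at [0] is never used. *)

Section Euclidean.
Variable R : realType.

Definition dot3 (p q : 'rV[R]_3) : R := \sum_(k < 3) p 0 k * q 0 k.

Definition edist (p q : 'rV[R]_3) : R := Num.sqrt (dot3 (p - q) (p - q)).

Definition euclidean_isometry (phi : 'rV[R]_3 -> 'rV[R]_3) : Prop :=
  forall p q, edist (phi p) (phi q) = edist p q.

End Euclidean.

Section PeriodProblem.
Variable R : realType.
Local Notation C := (R[i]).

Definition expi (t : R) : C := (cos t +i* sin t)%C.

Definition antipode (z : C) : C := - (conjc z)^-1.

(* A list (c, a_1, ..., a_(m+1)) is given by [c : C] and [a : m.+1.-tuple C]. *)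
Definition period_poly m (a : m.+1.-tuple C) : {poly C} :=
  \prod_(j < m.+1)
    (('X - (tnth a j)%:P) * ('X + ((conjc (tnth a j))^-1)%:P)).

Definition period_form m (c : C) (a : m.+1.-tuple C) (z : C) : C :=
  c / z ^+ (m + 3) * (period_poly a).[z].

Definition period_solution m (c : C) (a : m.+1.-tuple C) : Prop :=
  let A h := (period_poly a)`_h in
  [/\ `|c| = 1 /\ (forall j, tnth a j != 0),
      - (conjc c / c) = \prod_(j < m.+1) (tnth a j / conjc (tnth a j)),
      conjc (c * A m) = - (c * A m.+2)
    & complex.Im (c * A m.+1) = 0].

End PeriodProblem.

Section Surfaces.
Variable R : realType.
Local Notation C := (R[i]).
Local Notation E3 := ('rV[R]_3).
Implicit Types (g f : C -> C) (X Y : C -> E3) (z d : C).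

(* The three complex 1-forms of the Weierstrass representation with Gauss map
   [g] and [omega = f dz], divided by [dz]. *)
Definition weierstrass_forms g f (z : C) (k : 'I_3) : C :=
  tnth [tuple (1 - g z ^+ 2) / 2 * f z;
              'i%C / 2 * (1 + g z ^+ 2) * f z;
              g z * f z] k.

Definition velocity (gamma : R -> C) (t : R) : C :=
  (derive1 (@complex.Re R \o gamma) t +i* derive1 (@complex.Im R \o gamma) t)%C.

Definition C1 (h : R -> R) : Prop :=
  (forall t : R, derivable h t 1) /\ continuous (derive1 h).

Definition C1_path (gamma : R -> C) : Prop :=
  C1 (@complex.Re R \o gamma) /\ C1 (@complex.Im R \o gamma).

(* [X = Re \int (phi_1, phi_2, phi_3)] on the punctured plane: increments of
   [X] are the real parts of the integrals of the Weierstrass forms along any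
   path.  In particular the existence of such an [X] says that the
   representation formula is well defined, and it determines [X] up to a
   translation. *)
Definition weierstrass_map g f X : Prop :=
  forall gamma : R -> C, C1_path gamma ->
    (forall t : R, t \in `[0, 1] -> gamma t != 0) ->
    forall k : 'I_3,
      X (gamma 1) 0 k - X (gamma 0) 0 k =
      (\int[lebesgue_measure]_(t in `[0, 1])
         complex.Re (weierstrass_forms g f (gamma t) k * velocity gamma t))%R.

Definition dir_deriv d X z : E3 := derive1 (fun s : R => X (z + s%:C%C * d)) 0.

(* [dirs_deriv [:: d1; ...; dn] X] is [D_d1 (... (D_dn X))]. *)
Definition dirs_deriv (w : seq C) X : C -> E3 := foldr dir_deriv X w.

Definition smooth_map X : Prop :=
  forall (w : seq C) (z : C), z != 0 ->
    {for z, continuous (dirs_deriv w X : R[i]^o -> E3)} /\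
    (forall d, derivable (fun s : R => dirs_deriv w X (z + s%:C%C * d)) 0 1).

Local Notation Du := (dir_deriv 1).
Local Notation Dv := (dir_deriv 'i%C).

(* Smooth, conformal and harmonic on the punctured plane, an immersion except
   at isolated points.  By conformality [dX = 0] wherever [Du X = 0]. *)
Definition branched_minimal_immersion X : Prop :=
  [/\ smooth_map X,
      (forall z, z != 0 -> Du (Du X) z + Dv (Dv X) z = 0),
      (forall z, z != 0 ->
         dot3 (Du X z) (Du X z) = dot3 (Dv X z) (Dv X z) /\
         dot3 (Du X z) (Dv X z) = 0)
    & (forall z, z != 0 -> \forall x \near (z : R[i]^o)^', Du X x != 0)].

Definition unit_normal X (N : C -> E3) : Prop :=
  forall z, z != 0 ->
    [/\ {for z, continuous (N : R[i]^o -> E3)},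
        dot3 (N z) (N z) = 1, dot3 (N z) (Du X z) = 0 & dot3 (N z) (Dv X z) = 0].

(* [X] descends to the quotient of the punctured plane by the antipodal map,
   and the quotient surface carries no continuous unit normal field. *)
Definition one_sided X : Prop :=
  (forall z, z != 0 -> X (antipode z) = X z) /\
  ~ (exists N, unit_normal X N /\
               forall z, z != 0 -> N (antipode z) = N z).

Definition defines_one_sided_surface f : Prop :=
  (exists X, weierstrass_map id f X) /\
  (forall X, weierstrass_map id f X ->
     branched_minimal_immersion X /\ one_sided X).

(* Equality, up to an isometry of space, of the surfaces parametrized by [X]
   and [Y]: the change of parameter [psi] is a homeomorphism of the punctured
   plane that induces one of its antipodal quotient.  In particular
   [phi] maps the image of [X] onto the image of [Y]. *)
Definition congruent_maps X Y : Prop :=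
  exists (phi : E3 -> E3) (psi psi' : C -> C),
    euclidean_isometry phi /\
    forall z, z != 0 ->
      [/\ psi z != 0 /\ psi' z != 0,
          psi' (psi z) = z /\ psi (psi' z) = z,
          {for z, continuous (psi : R[i]^o -> R[i]^o)} /\
          {for z, continuous (psi' : R[i]^o -> R[i]^o)},
          psi (antipode z) = antipode (psi z)
        & Y (psi z) = phi (X z)].

(* Congruence of the surfaces with Weierstrass data [(z, f1 dz)] and
   [(z, f2 dz)]. *)
Definition congruent_surfaces f1 f2 : Prop :=
  [/\ (exists X, weierstrass_map id f1 X), (exists Y, weierstrass_map id f2 Y)
    & forall X Y, weierstrass_map id f1 X -> weierstrass_map id f2 Y ->
        congruent_maps X Y].

(* Smooth convergence on compact subsets of the punctured plane, for suitable
   choices of the translations, of the surfaces with data [(z, f_ t dz)] to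
   the one with data [(z, f dz)]. *)
Definition surfaces_cvg (F : set_system R) (f_ : R -> C -> C) f : Prop :=
  exists (X_ : R -> C -> E3) (Y : C -> E3),
    [/\ (\forall t \near F, weierstrass_map id (f_ t) (X_ t)),
        weierstrass_map id f Y
      & forall (w : seq C) (K : set R[i]^o), compact K -> ~ K 0 ->
          {uniform K, (fun t => dirs_deriv w (X_ t) : R[i]^o -> E3) @ F -->
                      (dirs_deriv w Y : R[i]^o -> E3)}].

Definition henneberg_form (z : C) : C := z ^- 4 * (z ^+ 4 - 1).

Definition H2_form (z : C) : C := 'i%C * z ^- 5 * (z ^+ 6 - 1).

End Surfaces.

Section Family.
Variable R : realType.
Local Notation C := (R[i]).

Definition Rfun (r : R) : R := r - r^-1.

Definition Rinv (y : R) : R := xget 1 [set r : R | 0 < r /\ Rfun r = y].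

Lemma Rfun_bij (y : R) : exists! r : R, 0 < r /\ Rfun r = y.
Proof.
have y4 : 0 < y ^+ 2 + 4 by nra.
set s := Num.sqrt (y ^+ 2 + 4).
have s2 : s ^+ 2 = y ^+ 2 + 4 by rewrite sqr_sqrtr // ltW.
have s0 : 0 < s by rewrite sqrtr_gt0.
have r0 : 0 < (y + s) / 2 by nra.
exists ((y + s) / 2); split.
  split=> //; rewrite /Rfun; apply: (mulIf (lt0r_neq0 r0)).
  by rewrite mulrBl mulVf ?lt0r_neq0 //; nra.
move=> r [r_gt0 ry].
have -> : s = r + r^-1.
  have rV : r * r^-1 = 1 by rewrite divff // lt0r_neq0.
  have rV0 : 0 < r^-1 by rewrite invr_gt0.
  rewrite /s -ry (_ : _ + 4 = (r + r^-1) ^+ 2) ?sqrtr_sqr ?gtr0_norm ?addr_gt0 //.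
  by rewrite /Rfun; nra.
by rewrite -ry /Rfun; lra.
Qed.

Lemma RinvP (y : R) : 0 < Rinv y /\ Rfun (Rinv y) = y.
Proof.
have [r [ry _]] := Rfun_bij y.
exact: (@xgetPex _ 1 [set r : R | 0 < r /\ Rfun r = y] (ex_intro _ r ry)).
Qed.

Definition family_dom (t : R) : Prop :=
  pi / 4 < t <= pi / 3 \/ 2 * pi / 3 <= t < 3 * pi / 4.

Definition F0 (t : R) : R :=
  Num.sqrt (1 - 8 * cos (2 * t) - 8 * cos (4 * t)).

Definition r1 (t : R) : R :=
  Rinv (1 / (8 * Num.sqrt 2) *
        (Num.sqrt (F0 t - 3) / (cos t * cos (2 * t))) *
        (F0 t + 3 + 4 * cos (2 * t))).

Definition r2 (t : R) : R := Rinv (- (Num.sqrt (F0 t - 3) / Num.sqrt 2)).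

Definition H_list (t : R) : 3.-tuple C :=
  [tuple (r1 t)%:C%C; (r2 t)%:C%C * expi t; (r2 t)%:C%C * expi (- t)].

Definition H_form (t : R) : C -> C := period_form 'i%C (H_list t).

Definition rescaled_H_form (t : R) (z : C) : C := (r1 t)%:C%C * H_form t z.

Definition limit_form (z : C) : C :=
  'i%C / z ^+ 4 * (z - expi (pi / 4)) * (z + expi (pi / 4)) *
  (z - expi (- (pi / 4))) * (z + expi (- (pi / 4))).

End Family.

(* Main.v *)
Require Import Defs.
From HB Require Import structures.
From mathcomp Require Import all_boot all_order all_algebra.
From mathcomp Require Import complex ring lra.
From mathcomp Require Import all_classical all_reals all_analysis.
Import Order.TTheory GRing.Theory Num.Theory.
Import numFieldNormedType.Exports.
Local Open Scope classical_set_scope.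
Local Open Scope ring_scope.

Set Implicit Arguments.
Unset Strict Implicit.
Unset Printing Implicit Defensive.

(* Write [y_j = R(r_j)] and [B = y1 + 2 y2 cos t].  The period equations say
   that [A_2 = A_3 = A_4 = 0], so that off the origin
     [f_t = i (z - B - B z^-4 - z^-5)].
   For all the forms [a z + b + c z^-4 + d z^-5] at hand the Weierstrass forms
   have no residue: the surfaces are real parts of explicit Laurent polynomials,
   which are unique up to translation, depend linearly on the coefficients and
   become complex conjugate under the antipodal map when [(a, b, c, d)] is
   [(i A, - i B, - i B, - i A)] with [A] and [B] real.
   - A unit normal is plus or minus the inverse stereographic projection of [z],
     which is odd under the antipodal map; along a path from [1] to [-1] an
     invariant unit normal would have to change sign.
   - [t] and [pi - t] give opposite values of [B], exchanged by [z -> - z];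
     the limit form and the Henneberg form are exchanged by a rotation of [z].
   - [B -> 0] at [pi / 3], and [r1 -> 0], [r1 B -> - 1] at [pi / 4], so the
     convergence of the surfaces is the convergence of the two coefficients. *)

(** * Real and imaginary parts; derivatives of plane curves and of Laurent polynomials along them *)

Section ComplexCalculus.
Variable R : realType.
Local Notation C := (R[i]).
Implicit Types (z w c : C) (gamma : R -> C).

Lemma ReD z w : complex.Re (z + w) = complex.Re z + complex.Re w.
Proof. by case: z; case: w. Qed.

Lemma ImD z w : complex.Im (z + w) = complex.Im z + complex.Im w.
Proof. by case: z; case: w. Qed.

Lemma ReB z w : complex.Re (z - w) = complex.Re z - complex.Re w.
Proof. by case: z; case: w. Qed.

Lemma ImB z w : complex.Im (z - w) = complex.Im z - complex.Im w.
Proof. by case: z; case: w. Qed.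

Lemma ReM z w : complex.Re (z * w) =
  complex.Re z * complex.Re w - complex.Im z * complex.Im w.
Proof. by case: z; case: w. Qed.

Lemma ImM z w : complex.Im (z * w) =
  complex.Re z * complex.Im w + complex.Im z * complex.Re w.
Proof. by case: z; case: w. Qed.

Lemma ReV z : complex.Re z^-1 =
  complex.Re z / (complex.Re z ^+ 2 + complex.Im z ^+ 2).
Proof. by case: z. Qed.

Lemma ImV z : complex.Im z^-1 =
  - complex.Im z / (complex.Re z ^+ 2 + complex.Im z ^+ 2).
Proof. by case: z => a b /=; rewrite mulNr. Qed.

Lemma Re_conjc z : complex.Re (conjc z) = complex.Re z.
Proof. by case: z. Qed.

Lemma complex_ext z w :
  complex.Re z = complex.Re w -> complex.Im z = complex.Im w -> z = w.
Proof. by case: z => a b; case: w => c d /= -> ->. Qed.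

Lemma sqr_modulus_neq0 z : z != 0 ->
  complex.Re z ^+ 2 + complex.Im z ^+ 2 != 0.
Proof.
case: z => a b; rewrite eq_complex /= => h; apply: contra h.
by rewrite paddr_eq0 ?sqr_ge0 // !sqrf_eq0.
Qed.

(** A derivative in the two real coordinates, matching [velocity]; stating existence and value
    together lets the product and quotient rules be chained. *)
Definition has_velocity gamma (t : R) (d : C) : Prop :=
  is_derive t (1 : R) (@complex.Re R \o gamma) (complex.Re d) /\
  is_derive t (1 : R) (@complex.Im R \o gamma) (complex.Im d).

Lemma has_velocity_eq gamma t d d' :
  has_velocity gamma t d -> d = d' -> has_velocity gamma t d'.
Proof. by move=> h <-. Qed.

Lemma has_velocity_ext g1 g2 t d :
  g1 =1 g2 -> has_velocity g1 t d -> has_velocity g2 t d.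
Proof. by move=> /funext ->. Qed.

Lemma has_velocity_cst c t : has_velocity (fun=> c) t 0.
Proof. by split; apply: is_derive_cst. Qed.

Lemma has_velocityD g1 g2 t d1 d2 :
  has_velocity g1 t d1 -> has_velocity g2 t d2 ->
  has_velocity (fun s => g1 s + g2 s) t (d1 + d2).
Proof.
move=> [r1 i1] [r2 i2]; split.
- rewrite (_ : _ \o _ = (@complex.Re R \o g1) + (@complex.Re R \o g2)).
    by rewrite ReD; apply: is_deriveD.
  by apply/funext => s /=; rewrite ReD.
- rewrite (_ : _ \o _ = (@complex.Im R \o g1) + (@complex.Im R \o g2)).
    by rewrite ImD; apply: is_deriveD.
  by apply/funext => s /=; rewrite ImD.
Qed.

Lemma has_velocityM g1 g2 t d1 d2 :
  has_velocity g1 t d1 -> has_velocity g2 t d2 ->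
  has_velocity (fun s => g1 s * g2 s) t (d1 * g2 t + g1 t * d2).
Proof.
move=> [r1 i1] [r2 i2]; split.
- rewrite (_ : _ \o _ = (@complex.Re R \o g1) * (@complex.Re R \o g2)
                        - (@complex.Im R \o g1) * (@complex.Im R \o g2)).
    apply: is_derive_eq; rewrite ReD !ReM /= /GRing.scale /=; ring.
  by apply/funext => s /=; rewrite ReM.
- rewrite (_ : _ \o _ = (@complex.Re R \o g1) * (@complex.Im R \o g2)
                        + (@complex.Im R \o g1) * (@complex.Re R \o g2)).
    apply: is_derive_eq; rewrite ImD !ImM /= /GRing.scale /=; ring.
  by apply/funext => s /=; rewrite ImM.
Qed.

Lemma is_deriveV_real (f : R -> R) (t d : R) : f t != 0 ->
  is_derive t (1 : R) f d ->
  is_derive t (1 : R) (fun s => (f s)^-1) (- (f t) ^- 2 * d).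
Proof.
move=> ft0 [df <-]; split; first exact: derivableV.
by rewrite deriveV.
Qed.

Lemma has_velocityV gamma t d : gamma t != 0 ->
  has_velocity gamma t d ->
  has_velocity (fun s => (gamma s)^-1) t (- (d / gamma t ^+ 2)).
Proof.
move=> g0 [r1 i1].
set n := (@complex.Re R \o gamma) ^+ 2 + (@complex.Im R \o gamma) ^+ 2.
have n0 : n t != 0 by exact: sqr_modulus_neq0.
have dn : is_derive t (1 : R) n (2 * (complex.Re (gamma t) * complex.Re d
                                      + complex.Im (gamma t) * complex.Im d)).
  apply: is_derive_eq; rewrite /= /GRing.scale /=; ring.
have dV := is_deriveV_real n0 dn.
have nE : n t = complex.Re (gamma t) ^+ 2 + complex.Im (gamma t) ^+ 2 by [].
split.
- rewrite (_ : _ \o _ = (@complex.Re R \o gamma) * (fun s => (n s)^-1)).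
    apply: is_derive_eq; rewrite -exprVn.
    rewrite nE in n0 *; rewrite /= !expr2 /GRing.scale /= -!expr2.
    move: n0; case: (gamma t) => a b; case: (d) => p q /= n0.
    (* The squared modulus is multiplicative, [|z^2|^2 = |z|^4]; afterwards the only denominator is
       the one known to be nonzero. *)
    have -> : (a * a - b * b) ^+ 2 + (a * b + b * a) ^+ 2 = (a ^+ 2 + b ^+ 2) ^+ 2
      by ring.
    by field.
  by apply/funext => s /=; rewrite ReV.
- rewrite (_ : _ \o _ = - ((@complex.Im R \o gamma) * (fun s => (n s)^-1))).
    apply: is_derive_eq; rewrite -exprVn.
    rewrite nE in n0 *; rewrite /= !expr2 /GRing.scale /= -!expr2.
    move: n0; case: (gamma t) => a b; case: (d) => p q /= n0.
    have -> : (a * a - b * b) ^+ 2 + (a * b + b * a) ^+ 2 = (a ^+ 2 + b ^+ 2) ^+ 2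
      by ring.
    by field.
  by apply/funext => s /=; rewrite ImV mulNr.
Qed.

Lemma has_velocityX gamma t d n :
  has_velocity gamma t d ->
  has_velocity (fun s => gamma s ^+ n) t (gamma t ^+ n.-1 * d *+ n).
Proof.
move=> h; elim: n => [|n IH].
  rewrite mulr0n; exact: has_velocity_cst.
apply: (@has_velocity_ext (fun s => gamma s * gamma s ^+ n)).
  by move=> s; rewrite exprS.
apply: (has_velocity_eq (has_velocityM h IH)).
case: n {IH} => [|n] /=; first by rewrite !expr0 mulr0n mulr0 addr0 mulr1 mul1r.
rewrite [RHS]mulrS exprS; congr (_ + _); first by ring.
by rewrite mulrnAr mulrA.
Qed.

Lemma has_velocity_exprz gamma t d (n : int) : gamma t != 0 ->
  has_velocity gamma t d ->
  has_velocity (fun s => gamma s ^ n) t (n%:~R * gamma t ^ (n - 1) * d).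
Proof.
move=> g0 h; case: n => n.
- apply: (has_velocity_eq (has_velocityX n h)).
  rewrite -mulr_natl -mulrA -pmulrn.
  by case: n => [|n]; [rewrite /= !mulr0n !mul0r|rewrite /= -addn1 PoszD addrK].
- have gn0 : gamma t ^+ n.+1 != 0 by rewrite expf_neq0.
  apply: (has_velocity_eq (has_velocityV gn0 (has_velocityX n.+1 h))).
  have -> : gamma t ^ (Negz n - 1) = gamma t ^- n.+2.
    by rewrite NegzE -opprD -PoszD addn1.
  rewrite NegzE mulrNz /= -mulr_natl !exprS !mulNr; congr (- _).
  rewrite -pmulrn; field; by rewrite g0 expf_neq0.
Qed.

Lemma has_velocity_line z d t : has_velocity (fun s : R => z + s%:C%C * d) t d.
Proof.
split.
- rewrite (_ : _ \o _ = cst (complex.Re z) + (complex.Re d \*: id)).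
    by apply: is_derive_eq; rewrite /GRing.scale /= mulr1 add0r.
  by apply/funext => s /=; rewrite ReD ReM /= mul0r subr0 /GRing.scale /= mulrC.
- rewrite (_ : _ \o _ = cst (complex.Im z) + (complex.Im d \*: id)).
    by apply: is_derive_eq; rewrite /GRing.scale /= mulr1 add0r.
  by apply/funext => s /=; rewrite ImD ImM /= mul0r addr0 /GRing.scale /= mulrC.
Qed.

(* A Laurent polynomial, as a list of (coefficient, exponent) pairs. *)
Definition laurent (s : seq (C * int)) z : C :=
  \sum_(m <- s) m.1 * z ^ m.2.

(** A term of exponent 0 is kept with coefficient 0, so that differentiation is a plain map over the
    list. *)
Definition laurentD (s : seq (C * int)) : seq (C * int) :=
  [seq (m.1 * m.2%:~R, m.2 - 1) | m <- s].

Lemma has_velocity_laurent s gamma t d : gamma t != 0 ->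
  has_velocity gamma t d ->
  has_velocity (laurent s \o gamma) t (laurent (laurentD s) (gamma t) * d).
Proof.
move=> g0 h; rewrite /laurent; elim: s => [|m s IH].
  apply: (@has_velocity_ext (fun=> 0)).
    by move=> u /=; rewrite big_nil.
  by apply: (has_velocity_eq (has_velocity_cst _ _)); rewrite /= big_nil mul0r.
apply: (@has_velocity_ext (fun u => m.1 * gamma u ^ m.2 +
                                    \sum_(k <- s) k.1 * gamma u ^ k.2)).
  by move=> u /=; rewrite big_cons.
have h1 := has_velocityM (has_velocity_cst m.1 t) (has_velocity_exprz m.2 g0 h).
apply: (has_velocity_eq (has_velocityD h1 IH)).
by rewrite /= big_cons /= mul0r add0r mulrDl !mulrA.
Qed.

Lemma has_velocity_continuous gamma t d : has_velocity gamma t d ->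
  {for t, continuous (@complex.Re R \o gamma)} /\
  {for t, continuous (@complex.Im R \o gamma)}.
Proof.
move=> [[r1 _] [i1 _]].
by split; apply: differentiable_continuous; apply/derivable1_diffP.
Qed.

End ComplexCalculus.

(** * Explicit primitives of the Weierstrass forms, and uniqueness up to translation *)

Section WeierstrassPrimitives.
Variable R : realType.
Local Notation C := (R[i]).
Local Notation E3 := ('rV[R]_3).
Implicit Types (z w : C) (gamma : R -> C) (s : seq (C * int)).

Lemma derive1_is_derive (f : R -> R) (t d : R) :
  is_derive t (1 : R) f d -> derive1 f t = d.
Proof. by move=> h; rewrite derive1E derive_val. Qed.

Lemma C1_path_has_velocity gamma t : C1_path gamma ->
  has_velocity gamma t (velocity gamma t).
Proof.
move=> [[dr _] [di _]].
by split; rewrite /velocity /= derive1E; apply: derivableP.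
Qed.

Lemma has_velocity_C1 gamma (d : R -> C) :
  (forall t, has_velocity gamma t (d t)) ->
  continuous (@complex.Re R \o d) -> continuous (@complex.Im R \o d) ->
  C1_path gamma.
Proof.
move=> h cr ci; split; (split; first by move=> t; case: (h t) => -[? _] [? _]).
- rewrite (_ : derive1 _ = @complex.Re R \o d) //.
  by apply/funext => t; apply: derive1_is_derive; case: (h t).
- rewrite (_ : derive1 _ = @complex.Im R \o d) //.
  by apply/funext => t; apply: derive1_is_derive; case: (h t).
Qed.

(** The fundamental theorem of calculus along [gamma]: by the chain rule the integrand is the
    derivative of the real part of [laurent s], and it is continuous because the path is C1. *)
Lemma laurent_path_integral s gamma : C1_path gamma ->
  (forall t : R, t \in `[0, 1] -> gamma t != 0) ->
  complex.Re (laurent s (gamma 1)) - complex.Re (laurent s (gamma 0)) =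
  (\int[lebesgue_measure]_(t in `[0%R, 1%R])
     complex.Re (laurent (laurentD s) (gamma t) * velocity gamma t))%R.
Proof.
move=> gC1 g0; set f : R -> R := fun t => complex.Re (_ * _).
set F := @complex.Re R \o (laurent s \o gamma).
have hv (u : seq (C * int)) (t : R) : t \in `[0, 1] ->
    has_velocity (laurent u \o gamma) t
      (laurent (laurentD u) (gamma t) * velocity gamma t).
  by move=> t01; apply: has_velocity_laurent (g0 _ t01) _;
     apply: C1_path_has_velocity.
have dF (t : R) : t \in `[0, 1] -> is_derive t (1 : R) F (f t).
  by move=> /(hv s) [].
have cF (t : R) : t \in `[0, 1] -> {for t, continuous F}.
  by move=> t01; have [] := has_velocity_continuous (hv s t t01).
have cf : {within `[0, 1], continuous f}.
  apply: continuous_in_subspaceT => t /set_mem /= t01.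
  have [c1 c2] := has_velocity_continuous (hv (laurentD s) t t01).
  have [[_ c3] [_ c4]] := gC1.
  rewrite (_ : f = (fun t => (@complex.Re R \o (laurent (laurentD s) \o gamma)) t
                    * derive1 (@complex.Re R \o gamma) t
     - (@complex.Im R \o (laurent (laurentD s) \o gamma)) t
        * derive1 (@complex.Im R \o gamma) t)); last first.
    by apply/funext => u; rewrite /f ReM.
  by apply: cvgB; apply: cvgM; [exact: c1|exact: c3|exact: c2|exact: c4].
have oc (t : R) : t \in `]0, 1[ -> t \in `[0, 1] by exact: subset_itv_oo_cc.
have FC : derivable_oo_LRcontinuous F 0 1.
  split.
  - by move=> t /oc /dF [].
  - by apply: cvg_at_right_filter; apply: cF; rewrite in_itv /= lexx ler01.
  - by apply: cvg_at_left_filter; apply: cF; rewrite in_itv /= lexx ler01.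
have dFf : {in `]0, 1[, F^`()%classic =1 f}.
  by move=> t /oc /dF /derive1_is_derive.
by rewrite /Rintegral (continuous_FTC2 ltr01 cf FC dFf) -EFinB.
Qed.

(** Shifting the exponents 1, 0, -4, -5 by 0, 1 or 2 never gives -1: this is why the three
    Weierstrass forms have no residue. *)
Definition wform (a b c d : C) z : C := a * z + b + c / z ^+ 4 + d / z ^+ 5.

Definition wprim (a b c d : C) (k : 'I_3) : seq (C * int) :=
  tnth [tuple
    [:: (a / 4, 2); (b / 2, 1); (- a / 8, 4); (- b / 6, 3);
        (- c / 6, - 3%:Z); (- d / 8, - 4%:Z); (c / 2, - 1%:Z); (d / 4, - 2%:Z)];
    [:: ('i%C * a / 4, 2); ('i%C * b / 2, 1);
        ('i%C * a / 8, 4); ('i%C * b / 6, 3);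
        (- ('i%C * c) / 6, - 3%:Z); (- ('i%C * d) / 8, - 4%:Z);
        (- ('i%C * c) / 2, - 1%:Z); (- ('i%C * d) / 4, - 2%:Z)];
    [:: (a / 3, 3); (b / 2, 2); (- c / 2, - 2%:Z); (- d / 3, - 3%:Z)]] k.

Definition wmap (a b c d : C) z : E3 :=
  \row_k complex.Re (laurent (wprim a b c d k) z).

Lemma laurentD_wprim a b c d z k : z != 0 ->
  laurent (laurentD (wprim a b c d k)) z =
  weierstrass_forms id (wform a b c d) z k.
Proof.
move=> z0; rewrite /weierstrass_forms /wform.
case: k => -[|[|[|//]]] hk; rewrite !(tnth_nth 0) /= /laurent !big_cons big_nil /=.
all: rewrite ?(mulrNz, NegzE) -?pmulrn /=.
- by rewrite /exprz /=; field.
- by rewrite /exprz /=; field.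
- by rewrite /exprz /=; field.
Qed.

Lemma weierstrass_wmap a b c d :
  weierstrass_map id (wform a b c d) (wmap a b c d).
Proof.
move=> gamma gC1 g0 k; rewrite !mxE laurent_path_integral //.
apply: eq_Rintegral => t /set_mem /= t01.
by rewrite laurentD_wprim // g0.
Qed.

Lemma weierstrass_map_ext f1 f2 X :
  (forall z, z != 0 -> f1 z = f2 z) ->
  weierstrass_map id f1 X -> weierstrass_map id f2 X.
Proof.
move=> ef h gamma gC1 g0 k; rewrite h //; apply: eq_Rintegral => t /set_mem /= t01.
rewrite /weierstrass_forms ef ?g0 //.
Qed.

(* The imaginary part [Im z * t +- t (1 - t)] of this path vanishes only at the
   end points of [0, 1], up to the choice of the sign. *)
Lemma path_from_one z : z != 0 -> exists gamma,
  [/\ C1_path gamma, gamma 0 = 1, gamma 1 = z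
    & forall t : R, t \in `[0, 1] -> gamma t != 0].
Proof.
case: z => x y z0; set e : R := if 0 <= y then 1 else -1.
pose gamma (t : R) : C := ((1 + t * (x - 1)) +i* (t * (y + e * (1 - t))))%C.
exists gamma; split.
- apply: (@has_velocity_C1 _ (fun t => ((x - 1) +i* (y + e - 2 * e * t))%C)).
  + move=> t; split.
    * rewrite (_ : _ \o _ = cst 1 + (x - 1) \*: id).
        by apply: is_derive_eq; rewrite /= /GRing.scale /= mulr1 add0r.
      by apply/funext => u /=; rewrite /GRing.scale /= mulrC.
    * rewrite (_ : _ \o _ = (y + e) \*: id - e \*: (id * id)).
        by apply: is_derive_eq; rewrite /= /GRing.scale /=; ring.
      apply/funext => u.
      by change (u * (y + e * (1 - u)) = (y + e) * u - e * (u * u)); ring.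
  + by rewrite /comp /=; move=> t; apply: cvg_cst.
  + rewrite /comp /=; move=> t.
    apply: cvgB; first exact: cvg_cst.
    by apply: cvgM; [exact: cvg_cst|exact: cvg_id].
- by rewrite /gamma !mul0r addr0.
- by rewrite /gamma subrr mulr0 addr0 !mul1r addrC subrK.
- move=> t; rewrite in_itv /= => /andP[t0 t1]; rewrite eq_complex /=.
  apply/negP => /andP[/eqP ex /eqP /eqP]; rewrite mulf_eq0 => /orP[/eqP te|/eqP ey].
    by move: ex; rewrite te mul0r addr0 => /eqP; rewrite oner_eq0.
  (* [e] has the sign of [y], so a zero of [y + e (1 - t)] is a zero of both terms; what remains is
     the end point [z] itself. *)
  have [y0 t1e] : y = 0 /\ t = 1.
    by move: ey; rewrite /e; case: (lerP 0 y) => h ey; split; nra.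
  by move: ex z0; rewrite t1e y0 eq_complex /= mul1r eqxx andbT => /eqP;
    rewrite addrC subrK => ->.
Qed.

(** Along a path from [1] to [z] both increments equal the same integral. *)
Lemma weierstrass_map_unique f X Y z :
  weierstrass_map id f X -> weierstrass_map id f Y -> z != 0 ->
  X z = Y z + (X 1 - Y 1).
Proof.
move=> hX hY z0; have [gamma [gC1 g_0 g_1 gn]] := path_from_one z0.
apply/rowP => k; rewrite !mxE.
have := hX gamma gC1 gn k; rewrite -(hY gamma gC1 gn k) g_0 g_1.
by move: (X z 0 k) (X 1 0 k) (Y z 0 k) (Y 1 0 k) => p q r u; lra.
Qed.

End WeierstrassPrimitives.

(** * Iterated directional derivatives of the explicit maps; harmonicity and conformality *)

Section DirectionalDerivatives.
Variable R : realType.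
Local Notation C := (R[i]).
Local Notation E3 := ('rV[R]_3).
Implicit Types (z d c : C) (X G : C -> E3) (s : 'I_3 -> seq (C * int)).

Lemma is_derive_row n (f : R -> 'rV[R]_n) (D : 'rV[R]_n) (t : R) :
  (forall k, is_derive t (1 : R) (fun u => f u 0 k) (D 0 k)) ->
  is_derive t (1 : R) f D.
Proof.
move=> h.
have df : derivable f t (1 : R).
  by apply/derivable_mxP => i k; rewrite ord1; case: (h k).
split=> //; rewrite derive_mx //; apply/matrixP => i k; rewrite mxE ord1.
by case: (h k).
Qed.

Lemma line_near_neq0 z d : z != 0 ->
  \forall u \near (0 : R), z + u%:C%C * d != 0.
Proof.
move=> z0; have hv := has_velocity_line z d 0.
have [cr ci] := has_velocity_continuous hv.
have cn : {for (0 : R), continuous (fun u : R =>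
    complex.Re (z + u%:C%C * d) * complex.Re (z + u%:C%C * d) +
    complex.Im (z + u%:C%C * d) * complex.Im (z + u%:C%C * d))}.
  by apply: cvgD; apply: cvgM; (exact: cr || exact: ci).
have n0 : complex.Re (z + (0 : R)%:C%C * d) * complex.Re (z + (0 : R)%:C%C * d) +
    complex.Im (z + (0 : R)%:C%C * d) * complex.Im (z + (0 : R)%:C%C * d) != 0.
  by rewrite -!expr2; apply: sqr_modulus_neq0; rewrite mul0r addr0.
near=> u; have : complex.Re (z + u%:C%C * d) * complex.Re (z + u%:C%C * d) +
    complex.Im (z + u%:C%C * d) * complex.Im (z + u%:C%C * d) != 0.
  by near: u; exact: (cvgr_neq0 _ cn n0).
by apply: contra => /eqP ->; rewrite /= mul0r addr0.
Unshelve. all: by end_near. Qed.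

(** The constant [c] collects the directions of differentiation: deriving [Re (c F)] along [d] gives
    [Re (d c F')], a map of the same kind. *)
Definition laurent_map c s z : E3 :=
  \row_k complex.Re (c * laurent (s k) z).

(** [G] is prescribed off the origin only; this suffices because the line [z + u d] avoids the
    origin for small [u]. *)
Lemma dir_deriv_laurent_map c s (v : E3) G z d : z != 0 ->
  (forall x, x != 0 -> G x = laurent_map c s x + v) ->
  is_derive (0 : R) (1 : R) (fun u : R => G (z + u%:C%C * d))
    (laurent_map (d * c) (fun k => laurentD (s k)) z).
Proof.
move=> z0 hG.
apply: (@near_eq_is_derive _ _ _
  (fun u : R => laurent_map c s (z + u%:C%C * d) + v)).
  by near=> u; rewrite hG //; near: u; exact: line_near_neq0.
apply: is_derive_row => k.
rewrite (_ : (fun u => _) =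
  (fun u : R => complex.Re (c * laurent (s k) (z + u%:C%C * d))) + cst (v 0 k));
  last by apply/funext => u; rewrite !mxE.
have z0' : z + (0 : R)%:C%C * d != 0 by rewrite mul0r addr0.
have := has_velocity_laurent (s k) z0' (has_velocity_line z d 0).
move=> /(has_velocityM (has_velocity_cst c 0)) [].
rewrite /= !mul0r !add0r addr0 => h _.
apply: is_derive_eq; rewrite addr0 mxE; congr complex.Re; ring.
Unshelve. all: by end_near. Qed.

Definition dirs_laurent (w : seq C) s : C -> E3 :=
  laurent_map (\prod_(d <- w) d) (fun k => iter (size w) (@laurentD R) (s k)).

(** Induction on the word; the translation [v] disappears at the first derivative, hence survives
    only for the empty word. *)
Lemma dirs_deriv_laurent_map (w : seq C) s (v : E3) X z : z != 0 ->
  (forall x, x != 0 -> X x = laurent_map 1 s x + v) ->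
  dirs_deriv w X z = dirs_laurent w s z + (if w is [::] then v else 0).
Proof.
move=> + hX; elim: w z => [|d w IH] z z0.
  by rewrite /= hX // /dirs_laurent big_nil.
rewrite /= addr0 /dir_deriv derive1E.
have [_ ->] := dir_deriv_laurent_map d z0 IH.
by rewrite /dirs_laurent big_cons.
Qed.

Lemma derivable_dirs_deriv (w : seq C) s (v : E3) X z d : z != 0 ->
  (forall x, x != 0 -> X x = laurent_map 1 s x + v) ->
  derivable (fun u : R => dirs_deriv w X (z + u%:C%C * d)) 0 1.
Proof.
move=> z0 hX.
have hG x : x != 0 -> _ := fun x0 => dirs_deriv_laurent_map w x0 hX.
by have [] := dir_deriv_laurent_map d z0 hG.
Qed.

Lemma wmap_laurent_map a b c d :
  @wmap R a b c d = laurent_map 1 (wprim a b c d).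
Proof. by apply/funext => z; apply/rowP => k; rewrite !mxE mul1r. Qed.

Lemma wmap_Du a b c d (v : E3) X z : z != 0 ->
  (forall x, x != 0 -> X x = wmap a b c d x + v) ->
  dir_deriv 1 X z = \row_k complex.Re (weierstrass_forms id (wform a b c d) z k).
Proof.
rewrite wmap_laurent_map => z0 hX.
have := dirs_deriv_laurent_map [:: 1] z0 hX; rewrite /= addr0 => ->.
by apply/rowP => k; rewrite !mxE /= big_cons big_nil mulr1 mul1r laurentD_wprim.
Qed.

Lemma wmap_Dv a b c d (v : E3) X z : z != 0 ->
  (forall x, x != 0 -> X x = wmap a b c d x + v) ->
  dir_deriv 'i%C X z =
  \row_k (- complex.Im (weierstrass_forms id (wform a b c d) z k)).
Proof.
rewrite wmap_laurent_map => z0 hX.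
have := dirs_deriv_laurent_map [:: 'i%C] z0 hX; rewrite /= addr0 => ->.
apply/rowP => k; rewrite !mxE /= big_cons big_nil mulr1 laurentD_wprim //.
by rewrite mulrC ReiNIm.
Qed.

(** Both second derivatives are real parts of the same second derivative of the primitive,
    multiplied by [1] and by [i^2 = -1]. *)
Lemma wmap_harmonic a b c d (v : E3) X z : z != 0 ->
  (forall x, x != 0 -> X x = wmap a b c d x + v) ->
  dir_deriv 1 (dir_deriv 1 X) z + dir_deriv 'i%C (dir_deriv 'i%C X) z = 0.
Proof.
rewrite wmap_laurent_map => z0 hX.
have := dirs_deriv_laurent_map [:: 1; 1] z0 hX; rewrite /= addr0 => ->.
have := dirs_deriv_laurent_map [:: 'i%C; 'i%C] z0 hX; rewrite /= addr0 => ->.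
apply/rowP => k; rewrite !mxE /= !big_cons big_nil !mulr1 !mul1r -expr2 sqr_i.
by rewrite -ReD mulN1r subrr.
Qed.

Lemma sum3 (F : 'I_3 -> R) :
  \sum_k F k = F 0 + F 1 + F (2%:R : 'I_3).
Proof.
rewrite !big_ord_recl big_ord0 addr0 addrA.
by congr (F _ + F _ + F _); apply/val_inj.
Qed.

(** This is [f^2] times the identity [(1 - z^2)^2 / 4 - (1 + z^2)^2 / 4 + z^2 = 0]. *)
Lemma sum_sqr_weierstrass_forms (f : C -> C) z :
  weierstrass_forms id f z 0 ^+ 2 + weierstrass_forms id f z 1 ^+ 2 +
  weierstrass_forms id f z (2%:R : 'I_3) ^+ 2 = 0.
Proof.
rewrite /weierstrass_forms !(tnth_nth 0) /=.
rewrite !exprMn exprVn sqr_i.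
by field.
Qed.

(** Applied to the Weierstrass forms [phi], where [Du X = Re phi] and [Dv X = - Im phi], this is
    conformality. The two claims are the real part and half the imaginary part of the hypothesis. *)
Lemma isotropic_Re_Im (p q r : C) : p ^+ 2 + q ^+ 2 + r ^+ 2 = 0 ->
  complex.Re p * complex.Re p + complex.Re q * complex.Re q
    + complex.Re r * complex.Re r =
  complex.Im p * complex.Im p + complex.Im q * complex.Im q
    + complex.Im r * complex.Im r /\
  complex.Re p * complex.Im p + complex.Re q * complex.Im q
    + complex.Re r * complex.Im r = 0.
Proof.
case: p => p1 p2; case: q => q1 q2; case: r => r1 r2 h.
have h1 := congr1 (@complex.Re R) h; have h2 := congr1 (@complex.Im R) h.
by move: h1 h2; rewrite !expr2 /= => h1 h2; split; lra.
Qed.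

Lemma wmap_conformal a b c d (v : E3) X z : z != 0 ->
  (forall x, x != 0 -> X x = wmap a b c d x + v) ->
  dot3 (dir_deriv 1 X z) (dir_deriv 1 X z) =
    dot3 (dir_deriv 'i%C X z) (dir_deriv 'i%C X z) /\
  dot3 (dir_deriv 1 X z) (dir_deriv 'i%C X z) = 0.
Proof.
move=> z0 hX; rewrite (wmap_Du z0 hX) (wmap_Dv z0 hX) /dot3 !sum3 !mxE.
have [h1 h2] := isotropic_Re_Im (sum_sqr_weierstrass_forms (wform a b c d) z).
by rewrite !mulrNN !mulrN h1; split=> //; lra.
Qed.

(* The first two Weierstrass forms recover [f] as [phi_1 - i phi_2]. *)
Lemma wmap_branch_point a b c d (v : E3) X z : z != 0 ->
  (forall x, x != 0 -> X x = wmap a b c d x + v) ->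
  dir_deriv 1 X z = 0 -> wform a b c d z = 0.
Proof.
move=> z0 hX h0.
have [h1 _] := wmap_conformal z0 hX; move: h1 h0.
rewrite (wmap_Dv z0 hX) (wmap_Du z0 hX).
set phi := weierstrass_forms id (wform a b c d) z => h1 h0.
have re0 k : complex.Re (phi k) = 0.
  by have := congr1 (fun M : E3 => M 0 k) h0; rewrite !mxE.
(* By conformality [Dv X] has the same length as [Du X], so it vanishes too. *)
have im0 k : complex.Im (phi k) = 0.
  apply/eqP; move: h1; rewrite h0 /dot3 big1; last by move=> j _; rewrite mxE mul0r.
  move=> /esym/eqP; rewrite psumr_eq0 => [/allP /(_ k)|]; last first.
    by move=> j _; rewrite -expr2 sqr_ge0.
  by rewrite mem_index_enum => /(_ isT) /=; rewrite mxE -expr2 sqrf_eq0 oppr_eq0.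
have phi0 k : phi k = 0 by apply: complex_ext; rewrite ?re0 ?im0.
have -> : wform a b c d z = phi 0 - 'i%C * phi 1.
  rewrite /phi /weierstrass_forms !(tnth_nth 0) /= !mulrA -expr2 sqr_i.
  by field.
by rewrite !phi0 mulr0 subrr.
Qed.

End DirectionalDerivatives.

(** * Topology of the complex plane: continuity and isolated zeros *)

Section ComplexTopology.
Variable R : realType.
Local Notation C := (R[i]).
Local Notation E3 := ('rV[R]_3).
Implicit Types (z w d c : C) (X : C -> E3).

Lemma norm_real_complex (x : R) : `|x%:C%C| = `|x|%:C%C :> C.
Proof. by rewrite normc_def /= expr0n addr0 sqrtr_sqr. Qed.

Lemma norm_i : `|'i%C| = 1 :> C.
Proof. by rewrite normc_def /= expr0n add0r expr1n sqrtr1. Qed.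

Lemma norm_Re_le z : `|complex.Re z|%:C%C <= `|z|.
Proof.
by rewrite normc_def lecR -sqrtr_sqr ler_wsqrtr // lerDl sqr_ge0.
Qed.

Lemma norm_Im_le z : `|complex.Im z|%:C%C <= `|z|.
Proof.
by rewrite normc_def lecR -sqrtr_sqr ler_wsqrtr // lerDr sqr_ge0.
Qed.

Lemma norm_le_Re_Im z :
  `|z| <= (`|complex.Re z| + `|complex.Im z|)%:C%C.
Proof.
rewrite {1}(complexE z) rmorphD /=; apply: le_trans (ler_normD _ _) _.
by rewrite normrM norm_i mul1r !norm_real_complex.
Qed.

Lemma near_dist_lt z (e : R) : 0 < e ->
  \forall w \near (z : R[i]^o), `|z - w| < e%:C%C.
Proof.
move=> e0; have h : 0 < e%:C%C by rewrite ltcR.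
exact: (@cvgr_dist_lt _ R[i]^o _ _ _ id z (@cvg_id _ (nbhs (z : R[i]^o))) _ h).
Qed.

Lemma continuous_Re : continuous (@complex.Re R : R[i]^o -> R).
Proof.
move=> z; apply/(@cvgrPdist_lt _ _ _ (nbhs (z : R[i]^o))) => e e0; near=> w.
rewrite -ReB -ltcR; apply: (le_lt_trans (norm_Re_le (z - w))).
near: w; exact: near_dist_lt.
Unshelve. all: by end_near. Qed.

Lemma continuous_Im : continuous (@complex.Im R : R[i]^o -> R).
Proof.
move=> z; apply/(@cvgrPdist_lt _ _ _ (nbhs (z : R[i]^o))) => e e0; near=> w.
rewrite -raddfB -ltcR; apply: le_lt_trans (norm_Im_le (z - w)) _.
near: w; exact: near_dist_lt.
Unshelve. all: by end_near. Qed.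

Lemma cvg_complex T (F : set_system T) {FF : Filter F} (u : T -> C) (l : C) :
  complex.Re (u t) @[t --> F] --> complex.Re l ->
  complex.Im (u t) @[t --> F] --> complex.Im l ->
  (u : T -> R[i]^o) @ F --> (l : R[i]^o).
Proof.
move=> hr hi; apply/cvgrPdist_lt => e e0.
(* A positive element of [R[i]] is real, so the tolerance [e] can be halved in [R]. *)
have eE : e = (complex.Re e)%:C%C by rewrite RRe_real // gtr0_real.
have e0' : 0 < complex.Re e / 2 by rewrite divr_gt0 // -ltcR -eE.
near=> t; rewrite eE; apply: le_lt_trans (norm_le_Re_Im _) _.
rewrite ltcR [ltRHS]splitr; apply: ltrD; rewrite ?ReB ?ImB; near: t.
- exact: (cvgr_dist_lt _ _ hr).
- exact: (cvgr_dist_lt _ _ hi).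
Unshelve. all: by end_near. Qed.

Local Notation contc z f := {for z, continuous (f : R[i]^o -> R[i]^o)}.

Lemma contc_cst c z : contc z (fun=> c).
Proof. exact: (@cst_continuous R[i]^o R[i]^o c z). Qed.

Lemma contc_id z : contc z id.
Proof. exact: (@cvg_id _ (nbhs (z : R[i]^o))). Qed.

Lemma contcD (f g : C -> C) z :
  contc z f -> contc z g -> contc z (fun w => f w + g w).
Proof. exact: (@continuousD _ R[i]^o R[i]^o). Qed.

Lemma contcM (f g : C -> C) z :
  contc z f -> contc z g -> contc z (fun w => f w * g w).
Proof. exact: (@continuousM _ R[i]^o). Qed.

Lemma contcV (f : C -> C) z :
  f z != 0 -> contc z f -> contc z (fun w => (f w)^-1).
Proof. exact: (@cvgV _ _ (nbhs (z : R[i]^o))). Qed.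

Lemma continuous_laurent (s : seq (C * int)) z : z != 0 ->
  {for z, continuous (laurent s : R[i]^o -> R[i]^o)}.
Proof.
move=> z0; elim: s => [|m s IH].
  rewrite (_ : laurent _ = fun=> 0); first exact: contc_cst.
  by apply/funext => w; rewrite /laurent big_nil.
have cX n : contc z (fun w => w ^+ n).
  elim: n => [|n IHn]; first exact: contc_cst.
  rewrite (_ : (fun w => _) = (fun w => w * w ^+ n)).
    by apply: contcM IHn; exact: contc_id.
  by apply/funext => w; rewrite exprS.
rewrite (_ : laurent _ = (fun w => m.1 * w ^ m.2 + laurent s w)); last first.
  by apply/funext => w; rewrite /laurent big_cons.
apply: contcD IH; apply: contcM; first exact: contc_cst.
case: m.2 => n; first exact: cX.
by apply: contcV (cX _); rewrite expf_neq0.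
Qed.

Lemma cvg_row T (F : set_system T) {FF : Filter F} n (f : T -> 'rV[R]_n)
    (l : 'rV[R]_n) :
  (forall k, f t 0 k @[t --> F] --> l 0 k) -> f @ F --> l.
Proof.
move=> h; apply/cvgrPdist_le => /= e e0; near=> t.
rewrite /Num.Def.normr /= mx_normrE (bigmax_le _ (ltW e0)) //= => -[i k] _.
rewrite !mxE /= ord1; move: k; near: t; apply: filter_forall => /= k.
exact: ((cvgrPdist_le _ _).1 (h k)).
Unshelve. all: by end_near. Qed.

Lemma continuous_laurent_map c (s : 'I_3 -> seq (C * int)) z : z != 0 ->
  {for z, continuous (laurent_map c s : R[i]^o -> E3)}.
Proof.
move=> z0; apply: (@cvg_row _ (nbhs (z : R[i]^o))) => k; rewrite mxE.
under eq_fun do rewrite mxE.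
apply: (@continuous_comp R[i]^o R[i]^o R
  (fun w => c * laurent (s k) w) (@complex.Re R)); last exact: continuous_Re.
apply: contcM; [exact: contc_cst|exact: continuous_laurent].
Qed.

Lemma near_neq0 z : z != 0 -> \forall w \near (z : R[i]^o), w != 0.
Proof. exact: (@cvgr_neq0 _ R[i]^o _ _ _ id z (@cvg_id _ (nbhs (z : R[i]^o)))). Qed.

Lemma continuous_dirs_deriv (ds : seq C) (s : 'I_3 -> seq (C * int)) (v : E3) X z :
  z != 0 ->
  (forall x, x != 0 -> X x = laurent_map 1 s x + v) ->
  {for z, continuous (dirs_deriv ds X : R[i]^o -> E3)}.
Proof.
move=> z0 hX; set g := dirs_deriv ds X.
set G := (fun x => dirs_laurent ds s x + (if ds is [::] then v else 0)).
have gG x : x != 0 -> g x = G x by move=> x0; exact: dirs_deriv_laurent_map.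
have cG : {for z, continuous (G : R[i]^o -> E3)}.
  apply: (@continuousD _ _ R[i]^o); first exact: continuous_laurent_map.
  exact: (@cst_continuous R[i]^o E3 _ z).
have hGg : \forall x \near (z : R[i]^o), G x = g x.
  by near=> x; rewrite gG //; near: x; exact: near_neq0.
rewrite /prop_for /continuous_at gG //.
exact: cvg_trans (near_eq_cvg hGg) cG.
Unshelve. all: by end_near. Qed.

(** Write [p = q (X - z)^m] with [q] nonzero at [z]: near [z] the first factor stays nonzero by
    continuity, and the second vanishes at [z] at most. *)
Lemma near_nonroot (p : {poly C}) (z : C) : p != 0 ->
  \forall x \near (z : R[i]^o)^', p.[x] != 0.
Proof.
move=> p0; have [m [q]] := multiplicity_XsubC p z.
rewrite p0 /= => qz ->.
have cq (r : {poly C}) : contc z (horner r).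
  elim/poly_ind: r => [|r c IH].
    rewrite (_ : horner _ = fun=> 0); first exact: contc_cst.
    by apply/funext => x; rewrite horner0.
  rewrite (_ : horner _ = (fun x => r.[x] * x + c)); last first.
    by apply/funext => x; rewrite hornerMXaddC.
  apply: contcD; last exact: contc_cst.
  by apply: contcM IH _; exact: contc_id.
have hq : \forall x \near (z : R[i]^o)^', q.[x] != 0.
  by apply: nbhs_dnbhs; apply: (@cvgr_neq0 _ R[i]^o _ _ _ _ _ (cq q)).
near=> x; rewrite hornerM horner_exp hornerXsubC mulf_neq0 //.
  by near: x.
by rewrite expf_neq0 // subr_eq0; near: x; exact: (@nbhs_dnbhs_neq R[i]^o z).
Unshelve. all: by end_near. Qed.

(** Off the origin [x^5] times the form is the polynomial [a x^6 + b x^5 + c x + d], which is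
    nonzero because [a] or [b] is. *)
Lemma near_wform_neq0 a b c d z : z != 0 -> (a != 0) || (b != 0) ->
  \forall x \near (z : R[i]^o)^', wform a b c d x != 0.
Proof.
move=> z0 ab.
pose p : {poly C} := a%:P * 'X^6 + b%:P * 'X^5 + c%:P * 'X + d%:P.
have p0 : p != 0.
  apply/negP => /eqP p0; move: ab.
  have h6 : p`_6 = 0 by rewrite p0 coef0.
  have h5 : p`_5 = 0 by rewrite p0 coef0.
  move: h6 h5; rewrite /p !coefD !coefCM !coefXn !coefX !coefC /=.
  rewrite !(mulr0, mulr1, addr0, add0r) => -> ->.
  by rewrite eqxx.
near=> x.
have x0 : x != 0 by near: x; apply: nbhs_dnbhs; exact: near_neq0.
have px : p.[x] != 0 by near: x; exact: near_nonroot.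
apply: contra px => /eqP fx.
have -> : p.[x] = x ^+ 5 * wform a b c d x.
  by rewrite /p !hornerD !hornerCM !hornerXn hornerC hornerX /wform; field.
by rewrite fx mulr0.
Unshelve. all: by end_near. Qed.

Lemma wmap_branched_minimal_immersion a b c d (v : E3) X :
  (a != 0) || (b != 0) ->
  (forall x, x != 0 -> X x = wmap a b c d x + v) ->
  branched_minimal_immersion X.
Proof.
move=> ab hX; have hX' : forall x, x != 0 ->
    X x = laurent_map 1 (wprim a b c d) x + v.
  by move=> x /hX; rewrite wmap_laurent_map.
split=> [w z z0|z z0|z z0|z z0].
- split; first exact: continuous_dirs_deriv hX'.
  by move=> d'; exact: derivable_dirs_deriv hX'.
- exact: wmap_harmonic hX.
- exact: wmap_conformal hX.
- have n1 := near_wform_neq0 c d z0 ab.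
  have n2 := nbhs_dnbhs (near_neq0 z0).
  apply: filterS2 n1 n2 => x fx x0; apply: contra fx => /eqP h; apply/eqP.
  exact: (wmap_branch_point x0 hX h).
Qed.

End ComplexTopology.

(** * The antipodal symmetry, and unit normals in terms of the Gauss map *)

Section OneSidedness.
Variable R : realType.
Local Notation C := (R[i]).
Local Notation E3 := ('rV[R]_3).
Implicit Types (z d c : C) (X Y N : C -> E3).

Definition symmetric_form (A B : R) : C -> C :=
  wform ('i%C * A%:C%C) (- ('i%C * B%:C%C)) (- ('i%C * B%:C%C))
        (- ('i%C * A%:C%C)).

Definition symmetric_map (A B : R) : C -> E3 :=
  wmap ('i%C * A%:C%C) (- ('i%C * B%:C%C)) (- ('i%C * B%:C%C))
       (- ('i%C * A%:C%C)).

Lemma conjc_i : conjc 'i%C = - 'i%C :> C.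
Proof. by apply: complex_ext => /=; rewrite ?oppr0. Qed.

Lemma antipode_neq0 z : z != 0 -> antipode z != 0.
Proof. by move=> z0; rewrite oppr_eq0 invr_eq0 conjc_eq0. Qed.

Lemma conjcM z d : conjc (z * d) = conjc z * conjc d.
Proof. exact: rmorphM. Qed.

Lemma conjcN z : conjc (- z) = - conjc z.
Proof. exact: rmorphN. Qed.

Lemma conjc_laurent (s : seq (C * int)) z :
  conjc (laurent s z) = laurent [seq (conjc m.1, m.2) | m <- s] (conjc z).
Proof.
rewrite /laurent big_map rmorph_sum /=; apply: eq_bigr => m _.
rewrite rmorphM; congr (_ * _); case: m.2 => n; first exact: rmorphXn.
by rewrite /exprz -rmorphXn; exact: fmorphV.
Qed.

(* The primitives of the Weierstrass forms are turned into their complex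
   conjugates. *)
Lemma symmetric_map_antipode A B z : z != 0 ->
  symmetric_map A B (antipode z) = symmetric_map A B z.
Proof.
move=> z0; apply/rowP => k; rewrite !mxE -[RHS]Re_conjc conjc_laurent.
congr complex.Re; rewrite /antipode.
have w0 : conjc z != 0 by rewrite conjc_eq0.
have cA : conjc ('i%C * A%:C%C) = - ('i%C * A%:C%C).
  by apply: complex_ext; rewrite /=; ring.
have cB : conjc ('i%C * B%:C%C) = - ('i%C * B%:C%C).
  by apply: complex_ext; rewrite /=; ring.
have ci := conjc_i; have cV n : conjc n%:R^-1 = n%:R^-1 :> C.
  by rewrite -{2}(conjc_nat R n); exact: fmorphV.
(* With [w = conjc z] the antipode is [- 1 / w], which swaps the exponents [n] and [- n], while
   conjugation negates [a] and [b]. *)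
move: (conjc z) w0 cA cB => {z z0} w w0.
move: ('i%C * A%:C%C : C) ('i%C * B%:C%C : C) => a b ca cb.
case: k => -[|[|[|//]]] hk; rewrite /laurent /= !big_cons !big_nil /=.
- rewrite !(conjcM, conjcN) ca cb !cV.
  by rewrite /exprz /=; field; rewrite ?w0 ?oppr_eq0 ?oner_eq0.
- rewrite !(conjcM, conjcN) ca cb ci !cV.
  by rewrite /exprz /=; field; rewrite ?w0 ?oppr_eq0 ?oner_eq0.
- rewrite !(conjcM, conjcN) ca cb !cV.
  by rewrite /exprz /=; field; rewrite ?w0 ?oppr_eq0 ?oner_eq0.
Qed.

(* [gauss_prod N z] is [|z|^2 + 1] times the scalar product of [N z] with the
   inverse stereographic projection of the Gauss map [z]. *)
Definition gauss_prod N z : R :=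
  2 * (complex.Re z * N z 0 0 + complex.Im z * N z 0 1)
  + (complex.Re z * complex.Re z + complex.Im z * complex.Im z - 1)
    * N z 0 (2%:R : 'I_3).

Definition sqnorm1 z : R :=
  complex.Re z * complex.Re z + complex.Im z * complex.Im z + 1.

(** [p] and [q] below are [|z|] times the radial and, up to sign, the angular component of the
    horizontal part of the normal. Orthogonality kills [q] and ties [p] to [n2]; unit length then
    fixes both up to a common sign, which the square forgets. *)
Lemma unit_normal_algebra (x y n0 n1 n2 : R) :
  (x != 0) || (y != 0) ->
  n0 * n0 + n1 * n1 + n2 * n2 = 1 ->
  n0 * (1 - (x * x - y * y)) - n1 * (2 * x * y) + 2 * n2 * x = 0 ->
  - n0 * (2 * x * y) + n1 * (1 + (x * x - y * y)) + 2 * n2 * y = 0 ->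
  (2 * (x * n0 + y * n1) + (x * x + y * y - 1) * n2) ^+ 2
  = (x * x + y * y + 1) ^+ 2.
Proof.
move=> xy nn hre him; set r := x * x + y * y.
have r0 : 0 < r.
  by rewrite /r -!expr2 lt_def addr_ge0 ?sqr_ge0 // andbT paddr_eq0 ?sqr_ge0 //
    !sqrf_eq0 negb_and.
set p := x * n0 + y * n1; set q := y * n0 - x * n1.
have hq : (1 + r) * q = 0.
  have -> : (1 + r) * q =
    y * (n0 * (1 - (x * x - y * y)) - n1 * (2 * x * y) + 2 * n2 * x)
    - x * (- n0 * (2 * x * y) + n1 * (1 + (x * x - y * y)) + 2 * n2 * y).
    rewrite /r /q; ring.
  by rewrite hre him !mulr0 subrr.
have q0 : q = 0.
  by apply/eqP; move/eqP: hq; rewrite mulf_eq0 => /orP[/eqP h|//]; lra.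
have hp : p * (r - 1) = 2 * n2 * r.
  have : x * (n0 * (1 - (x * x - y * y)) - n1 * (2 * x * y) + 2 * n2 * x)
    + y * (- n0 * (2 * x * y) + n1 * (1 + (x * x - y * y)) + 2 * n2 * y) = 0.
    by rewrite hre him !mulr0 addr0.
  have -> : x * (n0 * (1 - (x * x - y * y)) - n1 * (2 * x * y) + 2 * n2 * x)
    + y * (- n0 * (2 * x * y) + n1 * (1 + (x * x - y * y)) + 2 * n2 * y)
    = 2 * n2 * r - p * (r - 1) by rewrite /r /p; ring.
  by move=> h; lra.
have pp : p ^+ 2 = r * (1 - n2 ^+ 2).
  have -> : p ^+ 2 = r * (n0 * n0 + n1 * n1) - q ^+ 2 by rewrite /r /p /q; ring.
  rewrite q0 expr0n subr0; congr (_ * _); lra.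
(* Square [hp] and substitute [pp]; a factor [r] cancels. *)
have key : (1 - n2 ^+ 2) * (r - 1) ^+ 2 = 4 * n2 ^+ 2 * r.
  apply: (mulfI (lt0r_neq0 r0)).
  rewrite mulrA -pp -exprMn hp; ring.
rewrite (_ : (2 * p + (r - 1) * n2) ^+ 2 =
  4 * p ^+ 2 + 4 * n2 * (p * (r - 1)) + n2 ^+ 2 * (r - 1) ^+ 2); last by ring.
rewrite pp hp (_ : n2 ^+ 2 * (r - 1) ^+ 2 =
  (r - 1) ^+ 2 - (1 - n2 ^+ 2) * (r - 1) ^+ 2); last by ring.
rewrite key; ring.
Qed.

(** Where the form does not vanish it can be divided out, leaving an equation in [z] and the normal
    alone. *)
Lemma unit_normal_regular a b c d (v : E3) X N z : z != 0 ->
  (forall x, x != 0 -> X x = wmap a b c d x + v) ->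
  unit_normal X N -> wform a b c d z != 0 ->
  gauss_prod N z ^+ 2 = sqnorm1 z ^+ 2.
Proof.
move=> z0 hX /(_ z z0) [_ nn nu nv] f0.
move: nu nv nn; rewrite (wmap_Du z0 hX) (wmap_Dv z0 hX) /dot3 !sum3 !mxE.
set phi := weierstrass_forms id (wform a b c d) z.
set n0 := N z 0 0; set n1 := N z 0 1; set n2 := N z 0 _ => nu nv nn.
(* Orthogonality to [Du X] and [Dv X] gives the real and, up to sign, the imaginary part of one
   complex equation. *)
have key : (n0%:C%C * phi 0 + n1%:C%C * phi 1 + n2%:C%C * phi (2%:R : 'I_3)) = 0.
  have Rr (r : R) (w : C) : complex.Re (r%:C%C * w) = r * complex.Re w.
    by rewrite ReM /= mul0r subr0.
  have Ir (r : R) (w : C) : complex.Im (r%:C%C * w) = r * complex.Im w.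
    by rewrite ImM /= mul0r addr0.
  apply: complex_ext; rewrite ?(ReD, ImD) ?(Rr, Ir) //.
  by apply: oppr_inj; rewrite oppr0 !opprD -!mulrN.
have {}key : n0%:C%C * (1 - z * z) + n1%:C%C * ('i%C * (1 + z * z))
             + 2 * n2%:C%C * z = 0.
  have [h|/eqP h] := eqVneq (2%:R * wform a b c d z) 0.
    by move: f0; move/eqP: h; rewrite mulf_eq0 pnatr_eq0 /= => ->.
  move/eqP: h => h; apply: (mulIf h); rewrite mul0r.
  rewrite -[RHS](mulr0 4) -key /phi /weierstrass_forms !(tnth_nth 0) /=.
  by field.
have hre := congr1 (@complex.Re R) key; have him := congr1 (@complex.Im R) key.
rewrite /gauss_prod /sqnorm1 -/n0 -/n1 -/n2.
move: z0 hre him {key phi nu nv f0}; case: (z) => x y.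
rewrite eq_complex /= negb_and => xy hre him.
by apply: unit_normal_algebra => //; lra.
Qed.

Lemma continuous_gauss_prod X N z : z != 0 -> unit_normal X N ->
  {for z, continuous (gauss_prod N : R[i]^o -> R)} /\
  {for z, continuous (sqnorm1 : R[i]^o -> R)}.
Proof.
move=> z0 /(_ z z0) [cN _ _ _].
have cNk k : {for z, continuous ((fun w => N w 0 k) : R[i]^o -> R)}.
  apply: (@continuous_comp R[i]^o E3 R N (fun M => M 0 k)) => //.
  exact: coord_continuous.
have cr := @continuous_Re R z; have ci := @continuous_Im R z.
have ck (k : R) : {for z, continuous ((fun=> k) : R[i]^o -> R)}.
  exact: (@cst_continuous R[i]^o R k z).
have cD (f g : R[i]^o -> R) : {for z, continuous f} -> {for z, continuous g} ->
    {for z, continuous (fun w => f w + g w)}.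
  exact: (@continuousD _ R R[i]^o).
have cM (f g : R[i]^o -> R) : {for z, continuous f} -> {for z, continuous g} ->
    {for z, continuous (fun w => f w * g w)}.
  exact: (@continuousM R R[i]^o).
split; rewrite /gauss_prod /sqnorm1.
- by apply: (cD); [apply: (cM); [|apply: (cD); apply: (cM)]|
    apply: (cM); [apply: (cD); [apply: (cD); apply: (cM)|]|]].
- by apply: (cD); [apply: (cD); apply: (cM)|].
Qed.

End OneSidedness.

(** * One-sidedness and congruences of the symmetric surfaces *)

Section SurfacesOfTheFamily.
Variable R : realType.
Local Notation C := (R[i]).
Local Notation E3 := ('rV[R]_3).
Implicit Types (z u c d : C) (X Y N : C -> E3).

(** At a branch point the tangent plane is lost, but regular points accumulate there and both sides
    are continuous. *)
Lemma unit_normal_gauss_prod a b c d (v : E3) X N z : z != 0 ->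
  (a != 0) || (b != 0) ->
  (forall x, x != 0 -> X x = wmap a b c d x + v) ->
  unit_normal X N -> gauss_prod N z ^+ 2 = sqnorm1 z ^+ 2.
Proof.
move=> z0 ab hX hN.
have [cG cS] := continuous_gauss_prod z0 hN.
pose h w := gauss_prod N w * gauss_prod N w - sqnorm1 w * sqnorm1 w.
have ch : {for z, continuous (h : R[i]^o -> R)}.
  apply: (@continuousB _ R R[i]^o); exact: (@continuousM R R[i]^o).
have [h0|h0] := eqVneq (h z) 0.
  by rewrite !expr2; apply/eqP; rewrite -subr_eq0; apply/eqP.
have n1 := near_wform_neq0 c d z0 ab.
have n2 := nbhs_dnbhs (near_neq0 z0).
have n3 := nbhs_dnbhs (@cvgr_neq0 _ _ _ _ (nbhs_filter (z : R[i]^o)) h _ ch h0).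
have FF : ProperFilter (dnbhs (z : R[i]^o)) := Proper_dnbhs_numFieldType z.
have [x [[fx x0] hx]] : exists x,
    [set x | wform a b c d x != 0 /\ x != 0] x /\ h x != 0.
  by apply: (@filter_ex _ _ FF); apply: filterS2 (filterI n1 n2) n3.
move: hx; rewrite /h -!expr2.
by rewrite (unit_normal_regular x0 hX hN fx) subrr eqxx.
Qed.

Lemma antipode1 : antipode 1 = -1 :> C.
Proof. by rewrite /antipode conjc1 invr1. Qed.

Lemma no_invariant_unit_normal a b c d (v : E3) X N :
  (a != 0) || (b != 0) ->
  (forall x, x != 0 -> X x = wmap a b c d x + v) ->
  unit_normal X N -> (forall z, z != 0 -> N (antipode z) = N z) -> False.
Proof.
move=> ab hX hN hNa.
have m10 : (-1 : C) != 0 by rewrite oppr_eq0 oner_eq0.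
have [gamma [gC1 g_0 g_1 gn]] := path_from_one m10.
set G : R -> R := fun t => gauss_prod N (gamma t).
have cG (t : R) : t \in `[0, 1] -> {for t, continuous G}.
  move=> t01; have [cr ci] :=
    has_velocity_continuous (C1_path_has_velocity t gC1).
  have cg : {for t, continuous (gamma : R -> R[i]^o)} by exact: cvg_complex.
  apply: (@continuous_comp R R[i]^o R gamma (gauss_prod N)) => //.
  by case: (continuous_gauss_prod (gn t t01) hN).
have N1 : N (-1) = N 1 by rewrite -antipode1 hNa ?oner_neq0.
(* At [1] and [-1] the factor [|z|^2 - 1] vanishes, leaving [2 Re z] times the first coordinate of
   one and the same normal. *)
have G1 : G 1 = - G 0.
  by rewrite /G g_0 g_1 /gauss_prod N1 /=; ring.
have wG : {within `[0, 1], continuous G}.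
  by apply: continuous_in_subspaceT => t /set_mem; exact: cG.
have mid : Num.min (G 0) (G 1) <= 0 <= Num.max (G 0) (G 1).
  by rewrite G1 ge_min le_max; apply/andP; split;
    rewrite !(oppr_ge0, oppr_le0); case: (lerP 0 (G 0)) => [_|/ltW ->]; rewrite ?orbT.
(* At a zero of [G] the square of [|z|^2 + 1] would have to vanish. *)
have [t t01 Gt] := IVT ler01 wG mid.
have := unit_normal_gauss_prod (gn t t01) ab hX hN.
rewrite -/(G t) Gt expr0n /= => /esym /eqP; rewrite sqrf_eq0 => /eqP.
rewrite /sqnorm1 -!expr2.
have := sqr_ge0 (complex.Re (gamma t)); have := sqr_ge0 (complex.Im (gamma t)).
by clear; move=> h1 h2 h3; lra.
Qed.

Lemma imag_neq0 (A : R) : A != 0 -> ('i%C * A%:C%C : C) != 0.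
Proof.
move=> A0; rewrite mulf_neq0 //; first by rewrite eq_complex /= oner_eq0 andbF.
by rewrite eq_complex /= eqxx andbT.
Qed.

(** Any Weierstrass map is a translate of [symmetric_map A B] and inherits its symmetry; [A != 0]
    keeps the branch points isolated. *)
Lemma symmetric_form_defines_one_sided_surface (A B : R) (f : C -> C) :
  A != 0 -> (forall z, z != 0 -> f z = symmetric_form A B z) ->
  defines_one_sided_surface f.
Proof.
move=> A0 hf.
have hW : weierstrass_map id f (symmetric_map A B).
  apply: weierstrass_map_ext (@weierstrass_wmap R _ _ _ _) => z z0.
  by rewrite hf.
split; first by exists (symmetric_map A B).
move=> X hX.
have XE x : x != 0 -> X x = symmetric_map A B x + (X 1 - symmetric_map A B 1).
  by move=> x0; exact: (weierstrass_map_unique hX hW).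
have ab : ('i%C * A%:C%C != 0 :> C) || (- ('i%C * B%:C%C) != 0 :> C).
  by rewrite imag_neq0.
split; first exact: wmap_branched_minimal_immersion ab XE.
split.
  move=> z z0; rewrite (XE _ (antipode_neq0 z0)) (XE z z0).
  by rewrite symmetric_map_antipode.
by move=> [N [hN hNa]]; exact: (no_invariant_unit_normal ab XE hN hNa).
Qed.

(* The rotation of angle [- arg (a + i b)] about the third axis, composed with
   the reflection in the horizontal plane if [s = -1]. *)
Definition axial_isometry (a b s : R) (p : E3) : E3 :=
  \row_k tnth [tuple a * p 0 0 + b * p 0 1; a * p 0 1 - b * p 0 0;
                     s * p 0 (2%:R : 'I_3)] k.

Lemma axial_isometryE (a b s : R) (p : E3) :
  [/\ axial_isometry a b s p 0 0 = a * p 0 0 + b * p 0 1,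
      axial_isometry a b s p 0 1 = a * p 0 1 - b * p 0 0
    & axial_isometry a b s p 0 (2%:R : 'I_3) = s * p 0 (2%:R : 'I_3)].
Proof. by split; rewrite mxE. Qed.

Lemma axial_isometryB (a b s : R) (p q : E3) :
  axial_isometry a b s (p - q) = axial_isometry a b s p - axial_isometry a b s q.
Proof.
apply/rowP => k; rewrite !mxE.
by case: k => -[|[|[|//]]] hk; rewrite !(tnth_nth 0) /= ?mxE; ring.
Qed.

Lemma axial_isometryP (a b s : R) (v w : E3) :
  a ^+ 2 + b ^+ 2 = 1 -> s ^+ 2 = 1 ->
  euclidean_isometry (fun p => axial_isometry a b s (p - v) + w).
Proof.
move=> hab hs p q; rewrite /edist; congr Num.sqrt.
rewrite opprD addrACA subrr addr0 -axial_isometryB opprB addrA subrK.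
move: (p - q) => x; rewrite /dot3 !sum3.
have [-> -> ->] := axial_isometryE a b s x.
move: (x 0 0) (x 0 1) (x 0 (2%:R : 'I_3)) => x0 x1 x2.
rewrite [LHS](_ : _ = (a ^+ 2 + b ^+ 2) * (x0 * x0 + x1 * x1)
                      + s ^+ 2 * (x2 * x2)); last by ring.
by rewrite hab hs !mul1r.
Qed.

(** For [|u| = 1] the rotation [z -> u z] commutes with the antipodal map since [1 / conjc u = u];
    the translations [v] and [w] are absorbed in the isometry. *)
Lemma congruent_maps_rotation (W1 W2 : C -> E3) X Y (v w : E3) u (a b s : R) :
  u * conjc u = 1 -> a ^+ 2 + b ^+ 2 = 1 -> s ^+ 2 = 1 ->
  (forall z, z != 0 -> X z = W1 z + v) ->
  (forall z, z != 0 -> Y z = W2 z + w) ->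
  (forall z, z != 0 -> W2 (u * z) = axial_isometry a b s (W1 z)) ->
  congruent_maps X Y.
Proof.
move=> uu hab hs hX hY hW.
have u0 : u != 0 by apply: contra_eqN uu => /eqP ->; rewrite mul0r eq_sym oner_eq0.
have cu0 : conjc u != 0 by rewrite conjc_eq0.
have cu : (conjc u)^-1 = u by rewrite -[LHS]mul1r -uu mulfK.
exists (fun p => axial_isometry a b s (p - v) + w),
  (fun z => u * z), (fun z => conjc u * z).
split; first exact: axial_isometryP.
move=> z z0; split.
- by split; rewrite mulf_neq0.
- by rewrite !mulrA [conjc u * u]mulrC uu mul1r.
- by split; apply: contcM; [exact: contc_cst|exact: contc_id|
    exact: contc_cst|exact: contc_id].
- rewrite /antipode conjcM invfM cu mulrN; congr (- _).
- by rewrite hY ?mulf_neq0 // hW // hX // addrK.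
Qed.

Lemma congruent_surfaces_rotation f1 f2 (W1 W2 : C -> E3) u (a b s : R) :
  u * conjc u = 1 -> a ^+ 2 + b ^+ 2 = 1 -> s ^+ 2 = 1 ->
  weierstrass_map id f1 W1 -> weierstrass_map id f2 W2 ->
  (forall z, z != 0 -> W2 (u * z) = axial_isometry a b s (W1 z)) ->
  congruent_surfaces f1 f2.
Proof.
move=> uu hab hs h1 h2 hW; split; [by exists W1|by exists W2|].
move=> X Y hX hY.
apply: (congruent_maps_rotation uu hab hs _ _ hW) => z z0.
- exact: (weierstrass_map_unique hX h1).
- exact: (weierstrass_map_unique hY h2).
Qed.

(** Under [z -> - z] the form [f dz] for [B] becomes the one for [- B] while the Gauss map changes
    sign: only the third coordinate is reversed, hence [s = -1]. *)
Lemma congruent_symmetric_forms (A B : R) f1 f2 :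
  (forall z, z != 0 -> f1 z = symmetric_form A B z) ->
  (forall z, z != 0 -> f2 z = symmetric_form A (- B) z) ->
  congruent_surfaces f1 f2.
Proof.
move=> h1 h2.
have w1 : weierstrass_map id f1 (symmetric_map A B).
  by apply: weierstrass_map_ext (@weierstrass_wmap R _ _ _ _) => z z0; rewrite h1.
have w2 : weierstrass_map id f2 (symmetric_map A (- B)).
  by apply: weierstrass_map_ext (@weierstrass_wmap R _ _ _ _) => z z0; rewrite h2.
have uu : (-1 : C) * conjc (-1) = 1 by rewrite conjcN conjc1 mulrNN mulr1.
have ab : 1 ^+ 2 + 0 ^+ 2 = 1 :> R by rewrite expr1n expr0n addr0.
have ss : (-1) ^+ 2 = 1 :> R by rewrite sqrrN expr1n.
apply: (congruent_surfaces_rotation uu ab ss w1 w2) => z z0.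
apply/rowP => k; rewrite !mxE mulN1r.
have -> : ('i%C * (- B)%:C%C : C) = - ('i%C * B%:C%C).
  by rewrite rmorphN /= mulrN.
move: ('i%C * A%:C%C : C) ('i%C * B%:C%C : C) => p q.
case: k => -[|[|[|//]]] hk; rewrite !(tnth_nth 0) /= ?mul1r ?mul0r ?addr0 ?subr0.
- congr complex.Re; rewrite /laurent /= !big_cons !big_nil /= /exprz /=.
  by field; rewrite ?z0 ?oppr_eq0 ?oner_eq0.
- congr complex.Re; rewrite /laurent /= !big_cons !big_nil /= /exprz /=.
  by field; rewrite ?z0 ?oppr_eq0 ?oner_eq0.
- rewrite mulN1r -[RHS]raddfN; congr complex.Re.
  rewrite /laurent /= !big_cons !big_nil /= /exprz /=.
  by field; rewrite ?z0 ?oppr_eq0 ?oner_eq0.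
Qed.

End SurfacesOfTheFamily.

(** * The polynomial of the list and the period equations *)

Section FamilyForms.
Variable R : realType.
Local Notation C := (R[i]).
Implicit Types (t : R) (z : C).

Lemma conjc_expi t : conjc (expi t) = expi (- t).
Proof. by rewrite /expi cosN sinN. Qed.

Lemma expiN_mul t : expi t * expi (- t) = 1 :> C.
Proof.
apply: complex_ext; rewrite ?ReM ?ImM /= cosN sinN; last by ring.
by rewrite mulrN opprK -!expr2 cos2Dsin2.
Qed.

Lemma expi_add t : expi t + expi (- t) = 2 * (cos t)%:C%C :> C.
Proof. by apply: complex_ext; rewrite /= ?cosN ?sinN; ring. Qed.

Lemma expi_neq0 t : expi t != 0 :> C.
Proof.
by apply: contra_eqN (expiN_mul t) => /eqP ->; rewrite mul0r eq_sym oner_eq0.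
Qed.

Definition sextic (c5 c4 c3 c2 c1 c0 : C) : {poly C} :=
  'X^6 + c5%:P * 'X^5 + c4%:P * 'X^4 + c3%:P * 'X^3 + c2%:P * 'X^2
  + c1%:P * 'X + c0%:P.

Lemma sexticE (s1 q1 s2 q2 s3 q3 : C) :
  ('X^2 + s1%:P * 'X + q1%:P) *
  (('X^2 + s2%:P * 'X + q2%:P) * ('X^2 + s3%:P * 'X + q3%:P)) =
  sextic (s1 + (s2 + s3))
    (q1 + (q2 + q3) + (s1 * (s2 + s3) + s2 * s3))
    (s1 * (q2 + q3) + (s2 + s3) * q1 + (s2 * q3 + s3 * q2) + s1 * (s2 * s3))
    (q1 * (q2 + q3) + q2 * q3 + s1 * (s2 * q3 + s3 * q2) + s2 * s3 * q1)
    (s1 * (q2 * q3) + q1 * (s2 * q3 + s3 * q2))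
    (q1 * (q2 * q3)).
Proof. by rewrite /sextic !(polyCD, polyCM); ring. Qed.

(** For [a = r e] and [b = e / r] with [|e| = 1] the coefficients are [- Rfun r * e] and [- e^2], so
    that [r] enters only through [Rfun r]. *)
Lemma linear_pair (a b : C) :
  ('X - a%:P) * ('X + b%:P) = 'X^2 + (b - a)%:P * 'X + (- (a * b))%:P.
Proof. by rewrite polyCB polyCN polyCM; ring. Qed.

(* With [y1 = R r1], [y2 = R r2] and [c = cos t], these are the two equations
   [A_4 = A_2] and [A_3 = 0] of the period problem. *)
Definition period_equations (y1 y2 c : R) : Prop :=
  y2 ^+ 2 - 2 * (2 * c ^+ 2 - 1) + y1 * (2 * y2 * c) = 1 /\
  2 * (2 * y2 * c) = y1 * (y2 ^+ 2 - 2 * (2 * c ^+ 2 - 1)).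

Lemma r1_gt0 t : 0 < r1 t.
Proof. by case: (RinvP (1 / (8 * Num.sqrt 2) *
  (Num.sqrt (F0 t - 3) / (cos t * cos (2 * t))) *
  (F0 t + 3 + 4 * cos (2 * t)))). Qed.

Lemma r2_gt0 t : 0 < r2 t.
Proof. by case: (RinvP (- (Num.sqrt (F0 t - 3) / Num.sqrt 2))). Qed.

Lemma Rfun_r1 t : Rfun (r1 t) =
  1 / (8 * Num.sqrt 2) * (Num.sqrt (F0 t - 3) / (cos t * cos (2 * t))) *
  (F0 t + 3 + 4 * cos (2 * t)).
Proof. by rewrite /r1; case: (RinvP (1 / (8 * Num.sqrt 2) *
  (Num.sqrt (F0 t - 3) / (cos t * cos (2 * t))) *
  (F0 t + 3 + 4 * cos (2 * t)))). Qed.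

Lemma Rfun_r2 t : Rfun (r2 t) = - (Num.sqrt (F0 t - 3) / Num.sqrt 2).
Proof. by rewrite /r2; case: (RinvP (- (Num.sqrt (F0 t - 3) / Num.sqrt 2))). Qed.

Definition Bcoef t : R := Rfun (r1 t) + 2 * Rfun (r2 t) * cos t.

Lemma period_equations_complex (y1 y2 c : R) :
  period_equations y1 y2 c ->
  y2%:C%C ^+ 2 - 2 * (2 * c%:C%C ^+ 2 - 1) + y1%:C%C * (2 * y2%:C%C * c%:C%C)
    = 1 :> C /\
  2 * (2 * y2%:C%C * c%:C%C) =
    y1%:C%C * (y2%:C%C ^+ 2 - 2 * (2 * c%:C%C ^+ 2 - 1)) :> C.
Proof.
by move=> [h1 h2]; split; apply: complex_ext; rewrite !expr2 /=; lra.
Qed.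

(** Here [e] and [e'] stand for [expi t] and [expi (- t)]: each coefficient is symmetric in them,
    hence a polynomial in [e e' = 1] and [e + e' = 2 c]. *)
Lemma sextic_period (y1 y2 c e e' : C) :
  e * e' = 1 -> e + e' = 2 * c ->
  y2 ^+ 2 - 2 * (2 * c ^+ 2 - 1) + y1 * (2 * y2 * c) = 1 ->
  2 * (2 * y2 * c) = y1 * (y2 ^+ 2 - 2 * (2 * c ^+ 2 - 1)) ->
  ('X^2 + (- y1)%:P * 'X + (-1)%:P) *
  (('X^2 + (- y2 * e)%:P * 'X + (- e ^+ 2)%:P) *
   ('X^2 + (- y2 * e')%:P * 'X + (- e' ^+ 2)%:P)) =
  sextic (- (y1 + 2 * y2 * c)) 0 0 0 (- (y1 + 2 * y2 * c)) (-1).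
Proof.
move=> ee es; rewrite sexticE => /eqP; rewrite -subr_eq0 => /eqP H1.
move=> /eqP; rewrite -subr_eq0 => /eqP H2.
have E1 : - y2 * e + - y2 * e' = - (2 * y2 * c).
  by rewrite -mulrDr es; ring.
have E2 : - e ^+ 2 + - e' ^+ 2 = - (2 * (2 * c ^+ 2 - 1)).
  rewrite -opprD (_ : e ^+ 2 + e' ^+ 2 = (e + e') ^+ 2 - 2 * (e * e')); last by ring.
  by rewrite es ee; ring.
have E3 : - y2 * e * (- y2 * e') = y2 ^+ 2.
  by rewrite mulrACA ee mulr1 mulrNN expr2.
have E4 : - y2 * e * - e' ^+ 2 + - y2 * e' * - e ^+ 2 = 2 * y2 * c.
  rewrite (_ : _ + _ = y2 * (e * e') * (e + e')); last by ring.
  by rewrite ee es; ring.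
have E5 : - e ^+ 2 * - e' ^+ 2 = 1.
  by rewrite mulrNN -exprMn ee expr1n.
rewrite E1 E2 E3 E4 E5 /sextic.
(* The coefficients of [X^4], [X^3] and [X^2] are the left sides of [H1], of [H2] and of [H1] with
   the opposite sign. *)
have -> : -1 + - (2 * (2 * c ^+ 2 - 1)) + (- y1 * - (2 * y2 * c) + y2 ^+ 2) = 0.
  by rewrite -[RHS]H1; ring.
have -> : - y1 * - (2 * (2 * c ^+ 2 - 1)) + - (2 * y2 * c) * -1 + 2 * y2 * c +
    - y1 * y2 ^+ 2 = 0.
  by rewrite -[RHS]H2; ring.
have -> : -1 * - (2 * (2 * c ^+ 2 - 1)) + 1 + - y1 * (2 * y2 * c) + y2 ^+ 2 * -1 = 0.
  by rewrite -[RHS]oppr0 -H1; ring.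
congr (_ + _%:P * _ + _ + _ + _ + _%:P * _ + _%:P).
all: ring.
Qed.

Lemma tnth_H_list t :
  [/\ tnth (H_list t) 0 = (r1 t)%:C%C,
      tnth (H_list t) 1 = (r2 t)%:C%C * expi t
    & tnth (H_list t) (2%:R : 'I_3) = (r2 t)%:C%C * expi (- t)].
Proof. by []. Qed.

Lemma big_ord3 (T : Type) (op : T -> T -> T) (idx : T) (F : 'I_3 -> T) :
  \big[op/idx]_j F j = op (F 0) (op (F 1) (op (F (2%:R : 'I_3)) idx)).
Proof.
rewrite !big_ord_recl big_ord0.
by congr (op (F _) (op (F _) (op (F _) _))); apply/val_inj.
Qed.

Lemma period_poly_H_list t :
  period_equations (Rfun (r1 t)) (Rfun (r2 t)) (cos t) ->
  period_poly (H_list t) =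
  sextic (- (Bcoef t)%:C%C) 0 0 0 (- (Bcoef t)%:C%C) (-1).
Proof.
move=> h; rewrite /period_poly big_ord3 mulr1.
have [-> -> ->] := tnth_H_list t.
have r10 : (r1 t)%:C%C != 0 :> C.
  by rewrite eq_complex /= eqxx andbT gt_eqF ?r1_gt0.
have r20 : (r2 t)%:C%C != 0 :> C.
  by rewrite eq_complex /= eqxx andbT gt_eqF ?r2_gt0.
have cV (x : R) : (x^-1)%:C%C = (x%:C%C)^-1 :> C by exact: fmorphV.
have y1E : (Rfun (r1 t))%:C%C = (r1 t)%:C%C - (r1 t)%:C%C^-1 :> C.
  by rewrite /Rfun rmorphB -cV.
have y2E : (Rfun (r2 t))%:C%C = (r2 t)%:C%C - (r2 t)%:C%C^-1 :> C.
  by rewrite /Rfun rmorphB -cV.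
rewrite !conjcM !conjc_real !conjc_expi opprK.
have ee := expiN_mul t; have es := expi_add t.
have eV : (expi t : C)^-1 = expi (- t).
  by apply: (mulfI (expi_neq0 t)); rewrite divff ?expi_neq0 // ee.
have eV' : (expi (- t) : C)^-1 = expi t by rewrite -eV invrK.
rewrite !invfM eV eV' !linear_pair.
rewrite mulfV //.
have -> : (r1 t)%:C%C^-1 - (r1 t)%:C%C = - (Rfun (r1 t))%:C%C :> C.
  by rewrite y1E opprB.
have s2E : (r2 t)%:C%C^-1 * expi t - (r2 t)%:C%C * expi t =
    - (Rfun (r2 t))%:C%C * expi t :> C by rewrite y2E -mulrBl opprB.
have s3E : (r2 t)%:C%C^-1 * expi (- t) - (r2 t)%:C%C * expi (- t) =
    - (Rfun (r2 t))%:C%C * expi (- t) :> C by rewrite y2E -mulrBl opprB.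
have q2E : - ((r2 t)%:C%C * expi t * ((r2 t)%:C%C^-1 * expi t)) =
    - (expi t ^+ 2) :> C by rewrite mulrACA mulfV // mul1r.
have q3E : - ((r2 t)%:C%C * expi (- t) * ((r2 t)%:C%C^-1 * expi (- t))) =
    - (expi (- t) ^+ 2) :> C by rewrite mulrACA mulfV // mul1r.
rewrite s2E s3E q2E q3E /Bcoef.
have [h1C h2C] := period_equations_complex h.
rewrite (sextic_period ee es h1C h2C).
move: (Rfun (r1 t)) (Rfun (r2 t)) (cos t) => y1 y2 c.
have -> : (y1 + 2 * y2 * c)%:C%C = y1%:C%C + 2 * y2%:C%C * c%:C%C :> C.
  by apply: complex_ext; rewrite /=; ring.
by [].
Qed.

Lemma horner_sextic (c5 c4 c3 c2 c1 c0 z : C) :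
  (sextic c5 c4 c3 c2 c1 c0).[z] = z ^+ 6 + c5 * z ^+ 5 + c4 * z ^+ 4
    + c3 * z ^+ 3 + c2 * z ^+ 2 + c1 * z + c0.
Proof. by rewrite /sextic !hornerD !hornerCM !hornerXn hornerC hornerX. Qed.

Lemma coef_sextic (c5 c4 c3 c2 c1 c0 : C) :
  [/\ (sextic c5 c4 c3 c2 c1 c0)`_2 = c2, (sextic c5 c4 c3 c2 c1 c0)`_3 = c3
    & (sextic c5 c4 c3 c2 c1 c0)`_4 = c4].
Proof.
by split; rewrite /sextic !coefD !coefCM !coefXn !coefX !coefC /=;
  rewrite !(mulr0, mulr1, addr0, add0r).
Qed.

Lemma H_form_symmetric t z :
  period_equations (Rfun (r1 t)) (Rfun (r2 t)) (cos t) -> z != 0 ->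
  H_form t z = symmetric_form 1 (Bcoef t) z.
Proof.
move=> h z0; rewrite /H_form /period_form period_poly_H_list // horner_sextic.
rewrite /symmetric_form /wform.
by move: ((Bcoef t)%:C%C) => B; field.
Qed.

Lemma H_list_period_solution t :
  period_equations (Rfun (r1 t)) (Rfun (r2 t)) (cos t) ->
  period_solution 'i%C (H_list t).
Proof.
move=> h; have [t0 t1 t2] := tnth_H_list t.
have r10 : (r1 t)%:C%C != 0 :> C.
  by rewrite eq_complex /= eqxx andbT gt_eqF ?r1_gt0.
have r20 : (r2 t)%:C%C != 0 :> C.
  by rewrite eq_complex /= eqxx andbT gt_eqF ?r2_gt0.
rewrite /period_solution period_poly_H_list //.
have [-> -> ->] :=
  coef_sextic (- (Bcoef t)%:C%C) 0 0 0 (- (Bcoef t)%:C%C) (-1).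
split.
- split; first exact: norm_i.
  move=> j; have : tnth (H_list t) j \in [:: tnth (H_list t) 0;
      tnth (H_list t) 1; tnth (H_list t) (2%:R : 'I_3)].
    by case: j => -[|[|[|//]]] hj; rewrite !inE !(tnth_nth 0) /= eqxx ?orbT.
  rewrite t0 t1 t2 !inE => /or3P[] /eqP -> //; by rewrite mulf_neq0 ?expi_neq0.
(* Both sides are 1: [a_1] is real and the arguments of [a_2] and [a_3] cancel. *)
- rewrite big_ord3 mulr1 t0 t1 t2 conjc_i !conjcM !conjc_real !conjc_expi opprK.
  have i0 : ('i%C : C) != 0 by rewrite eq_complex /= oner_eq0 andbF.
  rewrite mulNr divff // opprK divff // mul1r.
  by field; rewrite r20 !expi_neq0.
- by rewrite !mulr0 conjc0 oppr0.
- by rewrite mulr0.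
Qed.

End FamilyForms.

(** * Bounds on the domain, and verification of the period equations *)

Section FamilyParameters.
Variable R : realType.
Implicit Types (t : R).

Local Notation c2 t := (cos (2 * t)).

Lemma cos_double t : cos (2 * t) = 2 * cos t ^+ 2 - 1 :> R.
Proof. by rewrite (_ : 2 * t = t *+ 2) ?mulr_natl // cos_mulr2n; ring. Qed.

(** With [y] for this cosine, the double angle formula and [cos (2 pi / 3) = - y] give
    [(y + 1) (2 y - 1) = 0], and [y > 0]. *)
Lemma cos_pi3 : cos (pi / 3) = 1 / 2 :> R.
Proof.
have pi0 := pi_gt0 R.
set y := cos (pi / 3).
have y0 : 0 < y by rewrite cos_gt0_pihalf //; apply/andP; split; lra.
have h2 : cos (2 * (pi / 3)) = 2 * y ^+ 2 - 1 :> R by rewrite cos_double.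
have h3 : cos (2 * (pi / 3)) = - y :> R.
  by rewrite (_ : 2 * (pi / 3) = - (pi / 3) + pi); [rewrite cosDpi cosN|field].
have : (y + 1) * (2 * y - 1) = 0.
  by rewrite (_ : _ * _ = 2 * y ^+ 2 - 1 - - y); [rewrite -h2 -h3 subrr|ring].
by move=> /eqP; rewrite mulf_eq0 => /orP[] /eqP h; lra.
Qed.

Lemma cos_2pi3 : cos (2 * (pi / 3)) = - (1 / 2) :> R.
Proof. by rewrite cos_double cos_pi3; field. Qed.

Lemma cos_2pi4 : cos (2 * (pi / 4)) = 0 :> R.
Proof. by rewrite -[RHS]cos_pihalf; congr cos; field. Qed.

Lemma cos2_bounds_left t : pi / 4 < t <= pi / 3 ->
  [/\ - (1 / 2) <= c2 t, c2 t < 0 & 0 < cos t].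
Proof.
move=> /andP[h1 h2]; have pi0 := pi_gt0 R.
have i1 : 2 * t \in `[0, pi] by rewrite in_itv /=; apply/andP; split; lra.
have i2 : (2 * (pi / 3) : R) \in `[0, pi].
  by rewrite in_itv /=; apply/andP; split; lra.
have i3 : (pi / 2 : R) \in `[0, pi].
  by rewrite in_itv /=; apply/andP; split; lra.
split.
- by rewrite -cos_2pi3 leNgt ltr_cos // -leNgt; lra.
- by rewrite -cos_pihalf ltr_cos //; lra.
- by apply: cos_gt0_pihalf; apply/andP; split; lra.
Qed.

Lemma cos2_bounds t : family_dom t ->
  [/\ - (1 / 2) <= c2 t, c2 t < 0 & cos t != 0].
Proof.
case=> [/cos2_bounds_left[h1 h2 h3]|/andP[h1 h2]].
  by split=> //; rewrite gt_eqF.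
(* The reflection [t -> pi - t] maps the second interval to the first, keeps [cos (2 t)] and negates
   [cos t]. *)
have h : pi / 4 < pi - t <= pi / 3.
  by apply/andP; split; lra.
have [] := cos2_bounds_left h.
have e : cos (pi - t) = - cos t :> R by rewrite addrC cosDpi cosN.
rewrite !cos_double e sqrrN oppr_gt0 => g1 g2 g3; split=> //.
by rewrite lt_eqF.
Qed.

Lemma F0_sqr t : - (1 / 2) <= c2 t -> c2 t <= 0 ->
  F0 t ^+ 2 = 9 - 8 * c2 t - 16 * c2 t ^+ 2.
Proof.
move=> h1 h2; rewrite /F0 sqr_sqrtr.
  rewrite (_ : 4 * t = 2 * (2 * t)); last by ring.
  by rewrite (cos_double (2 * t)); ring.
rewrite (_ : 4 * t = 2 * (2 * t)); last by ring.
by rewrite (cos_double (2 * t)); nra.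
Qed.

Lemma F0_ge0 t : 0 <= F0 t.
Proof. exact: sqrtr_ge0. Qed.

(** With [k = cos (2 t)] one has [F0^2 - 9 = - 8 k (1 + 2 k)], nonnegative for [k] between -1/2 and
    0 and zero at these two values, which are attained at [pi / 3] and [pi / 4]. *)
Lemma F0_ge3 t : - (1 / 2) <= c2 t -> c2 t <= 0 -> 3 <= F0 t.
Proof.
move=> h1 h2; have := F0_sqr h1 h2; have := F0_ge0 t.
by move: (F0 t) (c2 t) h1 h2 => f k h1 h2 f0 fE; nra.
Qed.

Lemma F0_gt3 t : - (1 / 2) < c2 t -> c2 t < 0 -> 3 < F0 t.
Proof.
move=> h1 h2; have := F0_sqr (ltW h1) (ltW h2); have := F0_ge0 t.
by move: (F0 t) (c2 t) h1 h2 => f k h1 h2 f0 fE; nra.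
Qed.

Lemma family_period_equations t : family_dom t ->
  period_equations (Rfun (r1 t)) (Rfun (r2 t)) (cos t).
Proof.
move=> /cos2_bounds[h1 h2 c0]; have F3 := F0_ge3 h1 (ltW h2).
have FE := F0_sqr h1 (ltW h2).
rewrite /period_equations Rfun_r1 Rfun_r2 -cos_double.
have kE := cos_double t.
have w2 : Num.sqrt (F0 t - 3) ^+ 2 = F0 t - 3 by rewrite sqr_sqrtr ?subr_ge0.
have s2 : Num.sqrt 2 ^+ 2 = 2 :> R by rewrite sqr_sqrtr.
have s0 : Num.sqrt 2 != 0 :> R by rewrite gt_eqF // sqrtr_gt0.
have k0 : c2 t != 0 by rewrite lt_eqF.
(* What remains are rational identities in [f], [k], [c], [w] and [s], modulo the quadratic
   relations [FE], [kE], [w2] and [s2]. *)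
move: (Num.sqrt (F0 t - 3)) (Num.sqrt 2 : R) w2 s2 s0 => w s w2 s2 s0.
move: (F0 t) (c2 t) (cos t) h1 h2 c0 F3 FE kE w2 k0 => f k c h1 h2 c0 F3 FE kE w2 k0.
split.
- rewrite (_ : (- (w / s)) ^+ 2 = w ^+ 2 / s ^+ 2); last by field.
  rewrite (_ : _ * (2 * - (w / s) * c) =
    - (w ^+ 2 * (f + 3 + 4 * k)) / (4 * s ^+ 2 * k));
    last by field; rewrite ?s0 ?c0 ?k0.
  rewrite w2 s2.
  (* Since [f^2 - 9 = - 8 k - 16 k^2], every term now has a factor [k], which cancels the
     denominator. *)
  rewrite (_ : (f - 3) * (f + 3 + 4 * k) = f ^+ 2 - 9 + 4 * k * (f - 3)); last by ring.
  by rewrite FE; field.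
- rewrite (_ : (- (w / s)) ^+ 2 = w ^+ 2 / s ^+ 2); last by field.
  rewrite w2 s2.
  (* The factors [f + 3 + 4 k] and [f - 3 - 4 k] give a difference of squares, equal to
     [- 32 k (1 + k)]; then [1 + k = 2 c^2] clears the denominator [c k]. *)
  rewrite [RHS](_ : _ = w * ((f ^+ 2) - (3 + 4 * k) ^+ 2) / (16 * s * c * k));
    last by field; rewrite ?s0 ?c0 ?k0.
  rewrite FE (_ : 9 - _ - _ - _ = - 32 * k * (1 + k)); last by ring.
  rewrite kE; rewrite kE in k0.
  by field; rewrite ?s0 ?c0 ?k0.
Qed.

(** Only [cos t] changes sign; [Rfun (r1 t)] is odd in it, and [Rfun (r2 t)] is unchanged. *)
Lemma Bcoef_pi_sub t : Bcoef (pi - t) = - Bcoef t.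
Proof.
have e : cos (pi - t) = - cos t :> R by rewrite addrC cosDpi cosN.
have e2 : c2 (pi - t) = c2 t by rewrite !cos_double e sqrrN.
have e4 : cos (4 * (pi - t)) = cos (4 * t) :> R.
  have q (x : R) : 4 * x = 2 * (2 * x) by ring.
  by rewrite !q !cos_double e sqrrN.
have F : F0 (pi - t) = F0 t by rewrite /F0 e2 e4.
rewrite /Bcoef !Rfun_r1 !Rfun_r2 F e e2 mulNr invrN; ring.
Qed.

Lemma family_dom_pi_sub t : family_dom t -> family_dom (pi - t).
Proof.
have pi0 := pi_gt0 R.
case=> /andP[h1 h2]; [right|left]; apply/andP; split; lra.
Qed.

End FamilyParameters.

(** * Limits of the parameters at [pi / 3] and [pi / 4] *)

Section FamilyLimits.
Variable R : realType.
Local Notation C := (R[i]).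
Implicit Types (t : R) (z : C).

Lemma cvg_cosM (k a : R) : cos (k * t) @[t --> a] --> cos (k * a).
Proof.
apply: (@continuous_cvg _ _ _ (nbhs a) _ (fun t => k * t) (@cos R)).
  exact: continuous_cos.
by apply: cvgM; [exact: cvg_cst|exact: cvg_id].
Qed.

Lemma cvg_F0 (a : R) : F0 t @[t --> a] --> F0 a.
Proof.
apply: (@continuous_cvg _ _ _ (nbhs a) _
  (fun t => 1 - 8 * cos (2 * t) - 8 * cos (4 * t)) (@Num.sqrt R)).
  exact: sqrt_continuous.
apply: cvgB; first apply: cvgB; first exact: cvg_cst.
- by apply: cvgM; [exact: cvg_cst|exact: cvg_cosM].
- by apply: cvgM; [exact: cvg_cst|exact: cvg_cosM].
Qed.

Lemma cvg_sqrtF0 (a : R) :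
  Num.sqrt (F0 t - 3) @[t --> a] --> Num.sqrt (F0 a - 3).
Proof.
apply: (@continuous_cvg _ _ _ (nbhs a) _ (fun t => F0 t - 3) (@Num.sqrt R)).
  exact: sqrt_continuous.
by apply: cvgB; [exact: cvg_F0|exact: cvg_cst].
Qed.

Lemma F0_pi3 : F0 (pi / 3) = 3 :> R.
Proof.
rewrite /F0 (_ : 4 * (pi / 3) = 2 * (2 * (pi / 3)) :> R); last by ring.
rewrite (cos_double (2 * _)) cos_2pi3.
rewrite (_ : _ - _ = 3 ^+ 2 :> R); last by field.
by rewrite sqrtr_sqr ger0_norm.
Qed.

Lemma F0_pi4 : F0 (pi / 4) = 3 :> R.
Proof.
rewrite /F0 (_ : 4 * (pi / 4) = 2 * (2 * (pi / 4)) :> R); last by ring.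
rewrite (cos_double (2 * _)) cos_2pi4.
rewrite (_ : _ - _ = 3 ^+ 2 :> R); last by ring.
by rewrite sqrtr_sqr ger0_norm.
Qed.

Lemma cvg_Rfun_r2 (a : R) : F0 a = 3 -> Rfun (r2 t) @[t --> a] --> (0 : R).
Proof.
move=> h; under eq_fun do rewrite Rfun_r2.
rewrite (_ : 0 = - (Num.sqrt (F0 a - 3) / Num.sqrt 2) :> R); last first.
  by rewrite h subrr sqrtr0 mul0r oppr0.
by apply: cvgN; apply: cvgM; [exact: cvg_sqrtF0|exact: cvg_cst].
Qed.

(** The denominator [cos t * cos (2 t)] tends to -1/4, so continuity suffices; at [pi / 4] it tends
    to 0. *)
Lemma cvg_Rfun_r1_pi3 : Rfun (r1 t) @[t --> (pi / 3 : R)] --> (0 : R).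
Proof.
under eq_fun do rewrite Rfun_r1.
rewrite (_ : 0 = 1 / (8 * Num.sqrt 2) *
  (Num.sqrt (F0 (pi / 3) - 3) / (cos (pi / 3) * cos (2 * (pi / 3)))) *
  (F0 (pi / 3) + 3 + 4 * cos (2 * (pi / 3))) :> R); last first.
  by rewrite F0_pi3 subrr sqrtr0 mul0r mulr0 mul0r.
apply: cvgM; last first.
  apply: cvgD; first by apply: cvgD; [exact: cvg_F0|exact: cvg_cst].
  by apply: cvgM; [exact: cvg_cst|exact: cvg_cosM].
apply: cvgM; first exact: cvg_cst.
apply: cvgM; first exact: cvg_sqrtF0.
apply: cvgV.
  by rewrite cos_pi3 cos_2pi3 mulrN oppr_eq0 mulf_neq0 // ?div1r ?invr_eq0.
by apply: cvgM; [exact: continuous_cos|exact: cvg_cosM].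
Qed.

Lemma near_pi4_right : \forall t \near (pi / 4 : R)^'+, pi / 4 < t < pi / 3.
Proof.
have pi0 := pi_gt0 R.
near=> t; apply/andP; split; near: t; first exact: nbhs_right_gt.
by apply: nbhs_right_lt; lra.
Unshelve. all: by end_near. Qed.

Lemma near_pi3_left : \forall t \near (pi / 3 : R)^'-, pi / 4 < t <= pi / 3.
Proof.
have pi0 := pi_gt0 R.
near=> t; apply/andP; split; last by apply: ltW; near: t; exact: nbhs_left_lt.
by near: t; apply: nbhs_left_gt; lra.
Unshelve. all: by end_near. Qed.

Lemma near_pi4_dom : \forall t \near (pi / 4 : R)^'+, family_dom t.
Proof.
apply: filterS near_pi4_right => t /andP[h1 h2]; left.
by rewrite h1 ltW.
Qed.

Lemma near_pi3_dom : \forall t \near (pi / 3 : R)^'-, family_dom t.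
Proof. by apply: filterS near_pi3_left => t h; left. Qed.

(** The strict sign allows division by [Rfun (r2 t)] in the limit at [pi / 4]. *)
Lemma Rfun_r2_lt0 t : pi / 4 < t < pi / 3 -> Rfun (r2 t) < 0.
Proof.
move=> /andP[h1 h2]; have pi0 := pi_gt0 R.
have [] := @cos2_bounds_left R t; first by rewrite h1 ltW.
move=> _ k0 _; have k1 : - (1 / 2) < cos (2 * t).
  rewrite -cos_2pi3 ltr_cos ?in_itv /=; first by lra.
    by apply/andP; split; lra.
  by apply/andP; split; lra.
have F3 := F0_gt3 k1 k0.
by rewrite Rfun_r2 oppr_lt0 divr_gt0 ?sqrtr_gt0 ?subr_gt0.
Qed.

(* The first period equation, solved for [R (r1 t)]. *)
Lemma Rfun_r1_mul t : pi / 4 < t < pi / 3 ->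
  Rfun (r1 t) * Rfun (r2 t) =
  (5 + 4 * cos (2 * t) - F0 t) / (4 * cos t).
Proof.
move=> ht; have /andP[h1 h2] := ht.
have dt : family_dom t by left; rewrite h1 ltW.
have [e1 _] := family_period_equations dt.
have [k1 k0 c0] := cos2_bounds dt.
have F3 := F0_ge3 k1 (ltW k0).
move: e1; rewrite -cos_double => e1.
have y2E : Rfun (r2 t) ^+ 2 = (F0 t - 3) / 2.
  by rewrite Rfun_r2 sqrrN expr_div_n !sqr_sqrtr ?subr_ge0.
apply: (mulIf c0); rewrite [RHS](_ : _ = (5 + 4 * cos (2 * t) - F0 t) / 4);
  last by field.
by lra.
Qed.

(** The product of [Rfun (r1 t)] and [Rfun (r2 t)] tends to the positive number
    [1 / (2 cos (pi / 4))] while the second factor tends to 0 from below; this bypasses the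
    indeterminate quotient in the formula for [r1]. *)
Lemma cvg_Rfun_r1_pi4 : Rfun (r1 t) @[t --> (pi / 4 : R)^'+] --> -oo.
Proof.
have pi0 := pi_gt0 R.
set g : R -> R := fun t => (5 + 4 * cos (2 * t) - F0 t) / (4 * cos t).
have c0 : 0 < cos (pi / 4) :> R.
  by apply: cos_gt0_pihalf; apply/andP; split; lra.
have g0 : 0 < g (pi / 4).
  by rewrite /g cos_2pi4 F0_pi4; apply: divr_gt0; lra.
have cg : g t @[t --> (pi / 4 : R)^'+] --> g (pi / 4).
  apply: cvg_at_right_filter; apply: cvgM.
    apply: cvgB; last exact: cvg_F0.
    apply: cvgD; first exact: cvg_cst.
    by apply: cvgM; [exact: cvg_cst|exact: cvg_cosM].
  apply: cvgV; first by rewrite mulf_neq0 // gt_eqF.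
  by apply: cvgM; [exact: cvg_cst|exact: continuous_cos].
have cy : Rfun (r2 t) @[t --> (pi / 4 : R)^'+] --> (0 : R).
  by apply: cvg_at_right_filter; apply: cvg_Rfun_r2; exact: F0_pi4.
apply/cvgrNyPle => A.
set M := `|A| + 1; have M0 : 0 < M by rewrite ltr_wpDl.
have AM : - M <= A.
  by rewrite /M opprD; have := ler_norm (- A); rewrite normrN; lra.
have e0 : 0 < g (pi / 4) / 2 / M by apply: divr_gt0 => //; apply: divr_gt0.
near=> t.
have ht : pi / 4 < t < pi / 3 by near: t; exact: near_pi4_right.
have y0 := Rfun_r2_lt0 ht.
have gt2 : g (pi / 4) / 2 < g t.
  by near: t; apply: (cvgr_gt _ cg); lra.
have yM : - (g (pi / 4) / 2 / M) < Rfun (r2 t).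
  by near: t; apply: (cvgr_gt _ cy); rewrite oppr_lt0.
apply: (le_trans _ AM).
have := Rfun_r1_mul ht; rewrite -/(g t) => E.
have yM2 : - (Rfun (r2 t) * M) < g (pi / 4) / 2.
  by rewrite -mulNr -ltr_pdivlMr // -ltrNl.
(* As [Rfun (r2 t)] is negative, this forces [Rfun (r1 t) + M < 0]. *)
have {}E : (Rfun (r1 t) + M) * Rfun (r2 t) > 0.
  by rewrite mulrDl E; lra.
rewrite -subr_le0 opprK; apply: ltW.
by rewrite -(nmulr_lgt0 _ y0).
Unshelve. all: by end_near. Qed.

(** From [Rfun r = (r - 1) (1 + 1 / r)] follows [|r - 1| <= |Rfun r|] for [r > 0]. *)
Lemma cvg_r2_pi4 : r2 t @[t --> (pi / 4 : R)^'+] --> (1 : R).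
Proof.
have cy : Rfun (r2 t) @[t --> (pi / 4 : R)^'+] --> (0 : R).
  by apply: cvg_at_right_filter; apply: cvg_Rfun_r2; exact: F0_pi4.
apply/cvgrPdist_lt => e e0; near=> t.
have h : `|0 - Rfun (r2 t)| < e by near: t; exact: (cvgr_dist_lt _ _ cy).
apply: le_lt_trans h; rewrite sub0r normrN.
have r0 := r2_gt0 t; have rV : r2 t * (r2 t)^-1 = 1 by rewrite divff // gt_eqF.
have rV0 : 0 < (r2 t)^-1 by rewrite invr_gt0.
have -> : Rfun (r2 t) = (r2 t - 1) * (1 + (r2 t)^-1).
  by rewrite /Rfun mulrDr mulr1 mulrBl rV; ring.
rewrite normrM distrC ler_peMr // ger0_norm; first by lra.
by lra.
Unshelve. all: by end_near. Qed.

(** As [1 / r = r - Rfun r > - Rfun r], the bound [Rfun r < - 1 / e] gives [r < e]. *)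
Lemma cvg_r1_pi4 : r1 t @[t --> (pi / 4 : R)^'+] --> (0 : R).
Proof.
have cy := cvg_Rfun_r1_pi4.
apply/cvgrPdist_lt => e e0; near=> t.
have h : Rfun (r1 t) < - e^-1 by near: t; exact: (cvgrNy_lt cy).
have r0 := r1_gt0 t; rewrite sub0r normrN gtr0_norm //.
rewrite -ltf_pV2 ?posrE //; move: h; rewrite /Rfun; lra.
Unshelve. all: by end_near. Qed.

(** The infinite limit is compensated exactly: [r1 * Rfun r1 = r1^2 - 1]. The other summand tends to
    0. *)
Lemma cvg_r1_Bcoef_pi4 :
  r1 t * Bcoef t @[t --> (pi / 4 : R)^'+] --> (-1 : R).
Proof.
have cy : Rfun (r2 t) @[t --> (pi / 4 : R)^'+] --> (0 : R).
  by apply: cvg_at_right_filter; apply: cvg_Rfun_r2; exact: F0_pi4.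
have cc : cos t @[t --> (pi / 4 : R)^'+] --> cos (pi / 4 : R).
  by apply: cvg_at_right_filter; exact: continuous_cos.
rewrite (_ : (fun t => _) = (fun t => r1 t * r1 t - 1
    + r1 t * (2 * Rfun (r2 t) * cos t))); last first.
  apply/funext => t; rewrite /Bcoef /Rfun mulrDr mulrBr divff //.
  by rewrite gt_eqF // r1_gt0.
suff : r1 t * r1 t - 1 + r1 t * (2 * Rfun (r2 t) * cos t)
    @[t --> (pi / 4 : R)^'+] --> (0 * 0 - 1 + 0 * (2 * 0 * cos (pi / 4)) : R).
  by rewrite !mul0r sub0r addr0.
have c1 := cvg_r1_pi4.
apply: cvgD; first by apply: cvgB; [exact: cvgM|exact: cvg_cst].
by apply: cvgM c1 _; apply: cvgM cc; apply: cvgM cy; exact: cvg_cst.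
Qed.

Lemma cvg_Bcoef_pi3 : Bcoef t @[t --> (pi / 3 : R)^'-] --> (0 : R).
Proof.
apply: cvg_at_left_filter.
rewrite (_ : 0 = 0 + 2 * 0 * cos (pi / 3) :> R);
  last by rewrite mulr0 mul0r addr0.
apply: cvgD; first exact: cvg_Rfun_r1_pi3.
apply: cvgM; last exact: continuous_cos.
apply: cvgM; first exact: cvg_cst.
by apply: cvg_Rfun_r2; exact: F0_pi3.
Qed.

End FamilyLimits.

(** * From convergence of the coefficients to convergence of the surfaces *)

Section SurfaceConvergence.
Variable R : realType.
Local Notation C := (R[i]).
Local Notation E3 := ('rV[R]_3).
Implicit Types (t : R) (z : C).

(** Factoring out the coefficients leaves functions of the exponents alone, which exposes the linear
    dependence on the coefficients. *)
Lemma laurent_iterD (n : nat) (s : seq (C * int)) z :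
  laurent (iter n (@laurentD R) s) z =
  \sum_(m <- s) m.1 * laurent (iter n (@laurentD R) [:: (1, m.2)]) z.
Proof.
have scale (c : C) k (x : C) (e : int) :
    laurent (iter k (@laurentD R) [:: (c * x, e)]) z =
    c * laurent (iter k (@laurentD R) [:: (x, e)]) z.
  elim: k x e => [|k IH] x e.
    by rewrite /laurent /= !big_seq1 /= mulrA.
  by rewrite !iterSr /= -IH mulrA.
have cons k (m : C * int) u :
    laurent (iter k (@laurentD R) (m :: u)) z =
    laurent (iter k (@laurentD R) [:: m]) z + laurent (iter k (@laurentD R) u) z.
  elim: k m u => [|k IH] m u; last by rewrite !iterSr /= IH.
  by rewrite /laurent /= big_cons big_seq1.
elim: s => [|[a e] s IH].
  rewrite big_nil; elim: n {scale cons} => [|n IH]; last by rewrite iterSr.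
  by rewrite /laurent big_nil.
by rewrite big_cons cons IH -[in LHS](mulr1 a) scale.
Qed.

(** The two maps on the right do not involve [A] or [B]: the convergence of all derivatives reduces
    to that of two real numbers. *)
Lemma dirs_laurent_wprim_lin (ds : seq C) (A B : R) z k :
  dirs_laurent ds (wprim ('i%C * A%:C%C) (- ('i%C * B%:C%C))
    (- ('i%C * B%:C%C)) (- ('i%C * A%:C%C))) z 0 k =
  A * dirs_laurent ds (wprim 'i%C 0 0 (- 'i%C)) z 0 k +
  B * dirs_laurent ds (wprim 0 (- 'i%C) (- 'i%C) 0) z 0 k.
Proof.
rewrite !mxE; set q := \prod_(d <- ds) d.
have Rr (r : R) (w : C) : r * complex.Re w = complex.Re (r%:C%C * w).
  by rewrite ReM /= mul0r subr0.
rewrite !Rr -ReD; congr complex.Re.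
rewrite !(laurent_iterD _ (wprim _ _ _ _ _)).
set h := fun e : int => laurent (iter (size ds) (@laurentD R) [:: (1, e)]) z.
by case: k => -[|[|[|//]]] hk; rewrite /= !big_cons !big_nil /= -!/(h _); field.
Qed.

Lemma uniform_cvg_row (F : set_system R) {FF : Filter F}
    (f : R -> C -> E3) (g : C -> E3) (K : set R[i]^o) :
  (forall e : R, 0 < e -> \forall t \near F,
     forall z, K z -> forall k, `|g z 0 k - f t z 0 k| < e) ->
  {uniform K, (fun t => f t : R[i]^o -> E3) @ F --> (g : R[i]^o -> E3)}.
Proof.
move=> h P /uniform_nbhs [E [entE EP]].
move: entE; rewrite -entourage_ballE => -[e /= e0 eE].
rewrite /fmap /=; apply: filterS (h e e0) => t ht; apply: EP => z Kz.
by apply: eE => /=; split=> // i k; rewrite ord1; exact: ht.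
Qed.

Lemma compact_laurent_map_bounded (K : set R[i]^o) (c : C)
    (s : 'I_3 -> seq (C * int)) : compact K -> ~ K 0 ->
  exists2 M : R, 0 < M & forall z, K z -> forall k, `|laurent_map c s z 0 k| <= M.
Proof.
move=> cK K0.
have cf : {within K, continuous (laurent_map c s : R[i]^o -> E3)}.
  apply: continuous_in_subspaceT => z /set_mem Kz.
  by apply: continuous_laurent_map; apply/eqP => z0; apply: K0; rewrite -z0.
have [M0 [_ hM]] := compact_bounded (continuous_compact cf cK).
have M1 : M0 < `|M0| + 1 by rewrite ltr_pwDr // ler_norm.
exists (`|M0| + 1); first by rewrite ltr_wpDl.
move=> z Kz k; apply: le_trans (hM _ M1 _ (ex_intro2 _ _ z Kz erefl)).
rewrite [leRHS]/Num.Def.normr /= mx_normrE.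
exact: (le_bigmax _ (fun ij : 'I_1 * 'I_3 => `|laurent_map c s z ij.1 ij.2|) (0, k)).
Qed.

Lemma symmetric_surfaces_cvg (F : set_system R) {FF : Filter F}
    (A B : R -> R) (A0 B0 : R) (f_ : R -> C -> C) (f : C -> C) :
  A t @[t --> F] --> A0 -> B t @[t --> F] --> B0 ->
  (\forall t \near F, forall z, z != 0 -> f_ t z = symmetric_form (A t) (B t) z) ->
  (forall z, z != 0 -> f z = symmetric_form A0 B0 z) ->
  surfaces_cvg F f_ f.
Proof.
move=> cA cB hf_ hf.
exists (fun t => symmetric_map (A t) (B t)), (symmetric_map A0 B0); split.
- apply: filterS hf_ => t ht.
  by apply: weierstrass_map_ext (@weierstrass_wmap R _ _ _ _) => z z0; rewrite ht.
- by apply: weierstrass_map_ext (@weierstrass_wmap R _ _ _ _) => z z0; rewrite hf.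
- move=> ds K cK K0.
  set U := dirs_laurent ds (wprim 'i%C 0 0 (- 'i%C)).
  set V := dirs_laurent ds (wprim 0 (- 'i%C) (- 'i%C) 0).
  have [M M0 hM] : exists2 M : R, 0 < M & forall z, K z -> forall k, `|U z 0 k| <= M.
    exact: compact_laurent_map_bounded.
  have [N N0 hN] : exists2 M : R, 0 < M & forall z, K z -> forall k, `|V z 0 k| <= M.
    exact: compact_laurent_map_bounded.
  have E (a b : R) z k : z != 0 ->
      dirs_deriv ds (symmetric_map a b) z 0 k = a * U z 0 k + b * V z 0 k.
    move=> z0; rewrite -dirs_laurent_wprim_lin.
    rewrite (@dirs_deriv_laurent_map R ds (wprim ('i%C * a%:C%C)
      (- ('i%C * b%:C%C)) (- ('i%C * b%:C%C)) (- ('i%C * a%:C%C))) 0) //.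
      by case: (ds) => [|? ?]; rewrite addr0.
    by move=> x _; rewrite addr0 /symmetric_map wmap_laurent_map.
  (* On [K] the error is at most [|A0 - A t| M + |B0 - B t| N], and each summand is made smaller
     than [e / 2]. *)
  apply: uniform_cvg_row => e e0; near=> t => z Kz k.
  have z0 : z != 0 by apply/eqP => z0; apply: K0; rewrite -z0.
  rewrite !E // (_ : _ - _ = (A0 - A t) * U z 0 k + (B0 - B t) * V z 0 k);
    last by ring.
  apply: le_lt_trans (ler_normD _ _) _; rewrite !normrM (splitr e).
  have hA : `|A0 - A t| < e / 2 / M.
    by near: t; apply: (cvgr_dist_lt _ _ cA); rewrite !divr_gt0.
  have hB : `|B0 - B t| < e / 2 / N.
    by near: t; apply: (cvgr_dist_lt _ _ cB); rewrite !divr_gt0.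
  apply: ltrD.
  - apply: le_lt_trans (_ : `|A0 - A t| * M < _); last by rewrite -ltr_pdivlMr.
    by apply: ler_wpM2l => //; exact: hM.
  - apply: le_lt_trans (_ : `|B0 - B t| * N < _); last by rewrite -ltr_pdivlMr.
    by apply: ler_wpM2l => //; exact: hN.
Unshelve. all: by end_near. Qed.

End SurfaceConvergence.

(** * The rescaled limit and Henneberg's surface *)

Section HennebergLimit.
Variable R : realType.
Local Notation C := (R[i]).
Local Notation E3 := ('rV[R]_3).
Implicit Types (t : R) (z : C).

(** The four factors multiply to [z^4 + 1], because [e e' = 1] and
    [e^2 + e'^2 = 2 cos (pi / 2) = 0]. *)
Lemma limit_form_symmetric z : z != 0 -> limit_form z = symmetric_form 0 (-1) z.
Proof.
move=> z0; rewrite /limit_form /symmetric_form /wform.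
have ee := expiN_mul (pi / 4 : R); have es := expi_add (pi / 4 : R).
have c2 : 2 * (2 * (cos (pi / 4) : R)%:C%C ^+ 2 - 1) = 0 :> C.
  have := cos_2pi4 R; rewrite cos_double => h.
  by apply: complex_ext; rewrite !expr2 /=; lra.
move: (expi (pi / 4)) (expi (- (pi / 4))) ((cos (pi / 4) : R)%:C%C) ee es c2.
move=> e e' c ee es c2.
have -> : 'i%C / z ^+ 4 * (z - e) * (z + e) * (z - e') * (z + e') =
    'i%C / z ^+ 4 * (z ^+ 4 - ((e + e') ^+ 2 - 2 * (e * e')) * z ^+ 2
                     + (e * e') ^+ 2) by ring.
rewrite ee es (_ : (2 * c) ^+ 2 - 2 * 1 = 2 * (2 * c ^+ 2 - 1)); last by ring.
rewrite c2 mul0r subr0 expr1n rmorph0 rmorphN rmorph1.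
by field.
Qed.

Lemma henneberg_form_wform z : z != 0 -> henneberg_form z = wform 0 1 (-1) 0 z.
Proof. by move=> z0; rewrite /henneberg_form /wform; field. Qed.

Lemma H2_form_symmetric z : z != 0 -> H2_form z = symmetric_form 1 0 z.
Proof.
move=> z0; rewrite /H2_form /symmetric_form /wform rmorph0 rmorph1.
by field.
Qed.

Lemma sin_pi4 : sin (pi / 4) = cos (pi / 4) :> R.
Proof.
rewrite -cosBpihalf (_ : pi / 4 - pi / 2 = - (pi / 4)); last by field.
by rewrite cosN.
Qed.

Lemma sqr_cos_pi4 : 2 * cos (pi / 4) ^+ 2 = 1 :> R.
Proof. by have := cos_2pi4 R; rewrite cos_double; lra. Qed.

(** Everything follows from [u^2 = i]; together with 1, the exponents are those of the nonzero terms
    of [wprim 0 1 (-1) 0]. *)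
Lemma expi_pi4_powers z : z != 0 -> let u := expi (pi / 4 : R) in
  [/\ (u * z) ^ 2 = 'i%C * z ^ 2, (u * z) ^ 3 = 'i%C * u * z ^ 3,
      (u * z) ^ (- 1%Z) = - ('i%C * u) * z ^ (- 1%Z),
      (u * z) ^ (- 2%Z) = - 'i%C * z ^ (- 2%Z)
    & (u * z) ^ (- 3%Z) = - u * z ^ (- 3%Z)].
Proof.
move=> z0 u; have u0 : u != 0 by exact: expi_neq0.
have i0 : ('i%C : C) != 0 by rewrite eq_complex /= oner_eq0 andbF.
have ii : 'i%C * 'i%C = -1 :> C by rewrite -expr2 sqr_i.
have u2 : u * u = 'i%C.
  have k2 := sqr_cos_pi4.
  by apply: complex_ext; rewrite /= sin_pi4; nra.
have uV : u^-1 = - ('i%C * u).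
  by apply: (mulfI u0); rewrite divff // mulrN mulrCA u2 ii opprK.
have iV : ('i%C : C)^-1 = - 'i%C.
  by apply: (mulfI i0); rewrite divff // mulrN ii opprK.
split; rewrite -?exprnN -?exprnP ?expr1 ?exprMn ?invfM.
- by rewrite (expr2 u) u2.
- by rewrite (exprSr u) (expr2 u) u2.
- by rewrite uV.
- by rewrite -(invfM u u) u2 iV.
- by rewrite -(invfM u u) u2 iV uV mulrNN (mulrAC 'i%C u) ii mulN1r.
Qed.

(** As [u^4 = -1], the substitution [z -> u z] turns [z^4 - 1] into [- (z^4 + 1)]. The Gauss map is
    multiplied by [u], so space rotates by [pi / 4] about the third axis and heights are kept. *)
Lemma limit_form_congruent_henneberg :
  congruent_surfaces (@limit_form R) (@henneberg_form R).
Proof.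
set u : C := expi (pi / 4); set k : R := cos (pi / 4).
have k2 : 2 * k ^+ 2 = 1 := sqr_cos_pi4.
have w1 : weierstrass_map id (@limit_form R) (symmetric_map 0 (-1)).
  apply: weierstrass_map_ext (@weierstrass_wmap R _ _ _ _) => z z0.
  by rewrite limit_form_symmetric.
have w2 : weierstrass_map id (@henneberg_form R) (wmap 0 1 (-1) 0).
  apply: weierstrass_map_ext (@weierstrass_wmap R _ _ _ _) => z z0.
  by rewrite henneberg_form_wform.
have uu : u * conjc u = 1 by rewrite conjc_expi expiN_mul.
have ab : k ^+ 2 + (- k) ^+ 2 = 1 by rewrite sqrrN; lra.
have ss : 1 ^+ 2 = 1 :> R by rewrite expr1n.
apply: (congruent_surfaces_rotation uu ab ss w1 w2) => z z0.
have uE : u = (k +i* k)%C by rewrite /u /expi sin_pi4.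
have [e2 e3 e1' e2' e3'] := expi_pi4_powers z0.
apply/rowP => j; rewrite !mxE rmorph0 mulr0 rmorphN rmorph1 mulrN mulr1 opprK.
rewrite -/u in e2 e3 e1' e2' e3'.
case: j => -[|[|[|//]]] hj; rewrite !(tnth_nth 0) /laurent /= !big_cons !big_nil /=.
- rewrite e3 e1' e3' !(mul0r, oppr0, mulr0, add0r, addr0) uE /exprz /=.
  (* The identity is linear in the powers of [z], which can therefore be treated as independent
     complex numbers. *)
  move: (z ^+ 3) (z ^+ 3)^-1 z^-1 => [x3 y3] [x3' y3'] [x1' y1'].
  by case: z {z0 e2 e3 e1' e2' e3'} => x1 y1; rewrite /=; field.
- rewrite e3 e1' e3' !(mul0r, oppr0, mulr0, add0r, addr0) uE /exprz /=.
  move: (z ^+ 3) (z ^+ 3)^-1 z^-1 => [x3 y3] [x3' y3'] [x1' y1'].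
  by case: z {z0 e2 e3 e1' e2' e3'} => x1 y1; rewrite /=; field.
- rewrite e2 e2' !(mul0r, oppr0, mulr0, add0r, addr0) /exprz /=.
  move: (z ^+ 2) (z ^+ 2)^-1 => [x2 y2] [x2' y2'].
  by rewrite /=; field.
Qed.

Lemma rescaled_H_form_symmetric t z : family_dom t -> z != 0 ->
  rescaled_H_form t z = symmetric_form (r1 t) (r1 t * Bcoef t) z.
Proof.
move=> /family_period_equations h z0; rewrite /rescaled_H_form H_form_symmetric //.
by rewrite /symmetric_form /wform rmorph1 rmorphM; field.
Qed.

(** For fixed [z] the form is linear in its two coefficients, which tend to [0] and [-1]. *)
Lemma rescaled_H_form_cvg z : z != 0 ->
  (rescaled_H_form t z : R[i]^o) @[t --> (pi / 4 : R)^'+] -->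
    (limit_form z : R[i]^o).
Proof.
move=> z0; rewrite limit_form_symmetric //.
set p : C := 'i%C * z - 'i%C / z ^+ 5; set q : C := - 'i%C - 'i%C / z ^+ 4.
have E (A B : R) : symmetric_form A B z = A%:C%C * p + B%:C%C * q.
  by rewrite /symmetric_form /wform /p /q; field.
have h : \forall t \near (pi / 4 : R)^'+,
    (symmetric_form (r1 t) (r1 t * Bcoef t) z : R[i]^o) = rescaled_H_form t z.
  by apply: filterS (near_pi4_dom R) => t dt; rewrite rescaled_H_form_symmetric.
apply: cvg_trans (near_eq_cvg h) _.
have c1 := @cvg_r1_pi4 R; have cB := @cvg_r1_Bcoef_pi4 R.
apply: cvg_complex.
- have ER (A B : R) : complex.Re (symmetric_form A B z) =
      A * complex.Re p + B * complex.Re q.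
    by rewrite E ReD !ReM /= !mul0r !subr0.
  rewrite ER; under eq_fun do rewrite ER.
  by apply: cvgD; (apply: cvgM; last exact: cvg_cst); [exact: c1|exact: cB].
- have EI (A B : R) : complex.Im (symmetric_form A B z) =
      A * complex.Im p + B * complex.Im q.
    by rewrite E ImD !ImM /= !mul0r !addr0.
  rewrite EI; under eq_fun do rewrite EI.
  by apply: cvgD; (apply: cvgM; last exact: cvg_cst); [exact: c1|exact: cB].
Qed.

Lemma symmetric_map_lin (A B : R) z k : symmetric_map A B z 0 k =
  A * wmap 'i%C 0 0 (- 'i%C) z 0 k + B * wmap 0 (- 'i%C) (- 'i%C) 0 z 0 k.
Proof.
have := dirs_laurent_wprim_lin [::] A B z k.
by rewrite /dirs_laurent big_nil /= -!wmap_laurent_map.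
Qed.

(** The increments of [X] are those of [symmetric_map 1 (Bcoef t)], and scaling by [r1 t] multiplies
    both coefficients. *)
Lemma weierstrass_map_rescale t (X : C -> E3) : family_dom t ->
  weierstrass_map id (H_form t) X ->
  weierstrass_map id (rescaled_H_form t) (fun z => r1 t *: X z).
Proof.
move=> dt hX gamma gC1 gn k; have pe := family_period_equations dt.
have h0 : weierstrass_map id (H_form t) (symmetric_map 1 (Bcoef t)).
  apply: weierstrass_map_ext (@weierstrass_wmap R _ _ _ _) => z z0.
  by rewrite H_form_symmetric.
have h1 : weierstrass_map id (rescaled_H_form t)
    (symmetric_map (r1 t) (r1 t * Bcoef t)).
  apply: weierstrass_map_ext (@weierstrass_wmap R _ _ _ _) => z z0.
  by rewrite rescaled_H_form_symmetric.
have e := etrans (hX gamma gC1 gn k) (esym (h0 gamma gC1 gn k)).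
rewrite -[RHS](h1 gamma gC1 gn k) [X in X - _]mxE [X in _ - X]mxE -mulrBr e.
have L := symmetric_map_lin.
have comb (r b x1 x0 y1 y0 u1 v1 u0 v0 : R) :
    x1 = 1 * u1 + b * v1 -> x0 = 1 * u0 + b * v0 ->
    y1 = r * u1 + r * b * v1 -> y0 = r * u0 + r * b * v0 ->
    r * (x1 - x0) = y1 - y0.
  by move=> -> -> -> ->; ring.
exact: comb (L _ _ _ _) (L _ _ _ _) (L _ _ _ _) (L _ _ _ _).
Qed.

Lemma H_list_cvg :
  (('i%C, tnth (H_list t) 0, tnth (H_list t) 1, tnth (H_list t) (2%:R : 'I_3))
     : R[i]^o * R[i]^o * R[i]^o * R[i]^o) @[t --> (pi / 4 : R)^'+] -->
    (('i%C, 0, expi (pi / 4), expi (- (pi / 4)))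
     : R[i]^o * R[i]^o * R[i]^o * R[i]^o).
Proof.
have c1 := @cvg_r1_pi4 R; have c2 := @cvg_r2_pi4 R.
have cc : cos t @[t --> (pi / 4 : R)^'+] --> cos (pi / 4 : R).
  by apply: cvg_at_right_filter; exact: continuous_cos.
have cs : sin t @[t --> (pi / 4 : R)^'+] --> sin (pi / 4 : R).
  by apply: cvg_at_right_filter; exact: continuous_sin.
apply: (cvg_pair (G := nbhs _) (H := nbhs _)); first
  apply: (cvg_pair (G := nbhs _) (H := nbhs _)); first
  apply: (cvg_pair (G := nbhs _) (H := nbhs _)).
- exact: cvg_cst.
- by apply: cvg_complex => /=; [exact: c1|exact: cvg_cst].
- apply: cvg_complex; rewrite /expi /=.
  + under eq_fun do rewrite mul0r subr0.
    by rewrite -[cos (pi / 4)]mul1r; exact: cvgM.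
  + under eq_fun do rewrite mul0r addr0.
    by rewrite -[sin (pi / 4)]mul1r; exact: cvgM.
- apply: cvg_complex; rewrite /expi /=.
  + under eq_fun do rewrite mul0r subr0 cosN.
    by rewrite cosN -[cos (pi / 4)]mul1r; exact: cvgM.
  + under eq_fun do rewrite mul0r addr0 sinN.
    by rewrite sinN -[- sin (pi / 4)]mul1r; apply: cvgM => //; exact: cvgN.
Qed.

End HennebergLimit.

Theorem mainTheorem5 (R : realType) :
  (forall t : R, family_dom t ->
     [/\ period_solution 'i%C (H_list t),
         defines_one_sided_surface (H_form t)
       & congruent_surfaces (H_form t) (H_form (pi - t))]) /\
  [/\ Rfun (r1 t) @[t --> (pi / 3 : R)^'-] --> (0 : R),
      Rfun (r2 t) @[t --> (pi / 3 : R)^'-] --> (0 : R)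
    & surfaces_cvg ((pi / 3 : R)^'-) (@H_form R) (@H2_form R)] /\
  [/\ Rfun (r1 t) @[t --> (pi / 4 : R)^'+] --> -oo /\
        Rfun (r2 t) @[t --> (pi / 4 : R)^'+] --> (0 : R),
      (('i%C, tnth (H_list t) 0, tnth (H_list t) 1, tnth (H_list t) 2%:R)
         : R[i]^o * R[i]^o * R[i]^o * R[i]^o) @[t --> (pi / 4 : R)^'+] -->
        (('i%C, 0, expi (pi / 4), expi (- (pi / 4)))
         : R[i]^o * R[i]^o * R[i]^o * R[i]^o),
      (forall (t : R) (X : R[i] -> 'rV[R]_3), family_dom t ->
         weierstrass_map id (H_form t) X ->
         weierstrass_map id (rescaled_H_form t) (fun z => r1 t *: X z)),
      (forall z : R[i], z != 0 ->
         (rescaled_H_form t z : R[i]^o) @[t --> (pi / 4 : R)^'+] -->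
           (limit_form z : R[i]^o))
    & surfaces_cvg ((pi / 4 : R)^'+) (@rescaled_H_form R) (@limit_form R) /\
        congruent_surfaces (@limit_form R) (@henneberg_form R)].
Proof.
(* The claims on the surfaces [H_form t] are read off from the two coefficients [1] and
   [Bcoef t]. *)
have sym1 (t : R) : family_dom t -> forall z, z != 0 ->
    H_form t z = symmetric_form 1 (Bcoef t) z.
  by move=> /family_period_equations h z z0; exact: H_form_symmetric.
split.
  move=> t dt; split.
  - exact/H_list_period_solution/family_period_equations.
  - exact: (symmetric_form_defines_one_sided_surface (oner_neq0 R) (sym1 t dt)).
  - apply: congruent_symmetric_forms (sym1 t dt) _.
    by rewrite -Bcoef_pi_sub; exact/sym1/family_dom_pi_sub.
split.
  split.
  - by apply: cvg_at_left_filter; exact: cvg_Rfun_r1_pi3.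
  - by apply: cvg_at_left_filter; apply: cvg_Rfun_r2; exact: F0_pi3.
  - apply: (@symmetric_surfaces_cvg R _ _ (fun=> 1) (@Bcoef R) 1 0).
    + exact: cvg_cst.
    + exact: cvg_Bcoef_pi3.
    + by apply: filterS (near_pi3_dom R) => t; exact: sym1.
    + exact: H2_form_symmetric.
split.
- split; first exact: cvg_Rfun_r1_pi4.
  by apply: cvg_at_right_filter; apply: cvg_Rfun_r2; exact: F0_pi4.
- exact: H_list_cvg.
- by move=> t X; exact: weierstrass_map_rescale.
- exact: rescaled_H_form_cvg.
- split; last exact: limit_form_congruent_henneberg.
  apply: (symmetric_surfaces_cvg (@cvg_r1_pi4 R) (@cvg_r1_Bcoef_pi4 R)).
  + by apply: filterS (near_pi4_dom R) => t dt z; exact: rescaled_H_form_symmetric.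
  + exact: limit_form_symmetric.
Qed.
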